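(* Define for integers $k\geq 0$ $$a(k)=\Big(\tfrac12-\tfrac{\sqrt{15}}{15}\Big)\big(2+\sqrt{15}\big)^k+\Big(\tfrac12+\tfrac{\sqrt{15}}{15}\Big)\big(2-\sqrt{15}\big)^k$$ (an integer sequence with $a(0)=1$, $a(1)=0$, $a(k+1)=4a(k)+11a(k-1)$). Then for all integers $n\geq0$, $k\geq0$, $$b_{23}\Big(5^{24k}n+\tfrac{11}{12}\big(5^{24k}-1\big)\Big)\equiv a(12k)\, b_{23}(n)\pmod{23},$$ and for every $r\in\{0,1,2,3\}$ and all $n,k\geq0$, $$b_{23}\Big(5^{24k+24}n+\tfrac{1}{12}\big(5^{24k+23}(12r+7)-11\big)\Big)\equiv 0\pmod{23}.$$
   Context: For an integer $l\geq 2$, a partition of a positive integer $n$ is $l$-regular if none of its parts is divisible by $l$. $b_l(n)$ denotes the number of $l$-regular partitions of $n$, with $b_l(0)=1$; equivalently $\sum_{n\ge0} b_l(n)q^n=\prod_{i\ge1}(1-q^{li})/(1-q^i)$. *)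

(* Defs.v *)
From HB Require Import structures.
From mathcomp Require Import all_boot all_order all_algebra.
Set Implicit Arguments. Unset Strict Implicit. Unset Printing Implicit Defensive.
Import GRing.Theory Num.Theory.

(* A partition of n is encoded as a nonincreasing n-tuple with entries in
   {0,...,n} summing to n (the parts are the nonzero entries; a partition of n
   has at most n parts, each at most n, so zero-padding to length n is a
   bijection). It is l-regular if no (nonzero) part is divisible by l. *)
Definition is_lregular_partition (l n : nat) (t : n.-tuple 'I_n.+1) : bool :=
  [&& sorted geq (map val t),
      sumn (map val t) == n &
      all (fun x => (x == 0) || ~~ (l %| x)) (map val t)].
Arguments is_lregular_partition : clear implicits.

Definition b (l n : nat) : nat := #|[pred t : n.-tuple 'I_n.+1 | is_lregular_partition l n t]|.

(* a(0)=1, a(1)=0, a(k+2) = 4 a(k+1) + 11 a(k); equal to the closed form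
   (1/2 - sqrt15/15)(2+sqrt15)^k + (1/2 + sqrt15/15)(2-sqrt15)^k. *)
Fixpoint a_aux (k : nat) : int * int :=
  match k with
  | 0 => (Posz 1, Posz 0)
  | k'.+1 => let: (x, y) := a_aux k' in (y, (Posz 4 * y + Posz 11 * x)%R)
  end.
Definition a (k : nat) : int := (a_aux k).1.

(* Main.v *)
Require Import Defs.
From HB Require Import structures.
From mathcomp Require Import all_boot all_order all_algebra all_field.
From mathcomp Require Import boolp zify ring.
Import GRing.Theory Num.Theory.
Set Implicit Arguments. Unset Strict Implicit. Unset Printing Implicit Defensive.

(** Modulo 23 the Frobenius turns the generating function of 23-regular partitions
    into E^22, where E is the Euler product at q. So it suffices to prove the Hecke
    relation at 25 for f = E^22 modulo 23,
    f(25n+22) = 13 f(n) - 9 [n = 2 mod 5] f(n) - 12 [n = 25j+22] f(j),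
    from which both congruences follow by iterating n -> 25n+22, since
    a(12k+1) = 0 mod 23.

    For the Hecke relation, the pentagonal number theorem gives the 5-dissection
    E = x + y + w with y = -q E(q^25), and the vanishing of the coefficients of E^3
    at exponents 2 mod 5 (Jacobi) gives x w = -y^2. Hence E is a root of a quintic
    over the series in q^5 whose constant term x^5 + 11 y^5 + w^5 is the norm of E
    over the fifth roots of unity, equal to E(q^5)^6 / E(q^25). The quintic yields a
    recurrence for the sections of the powers of E, and the Hecke relation becomes
    a polynomial identity in E and q E(q^25). *)

Local Open Scope ring_scope.

(** The Hecke relation reflects the weight 11 form [eta(12 tau)^22], whose coefficients sit at the
    exponents 12n+11: passing from n to 25n+22 multiplies the exponent by 25, and 5 divides it
    exactly when n = 2 mod 5. Modulo 23 one has 9 = 5^10 and 12 = 5^20, and 13 is the eigenvalue.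
    Strictly, [E/q] is the root of a quintic over Laurent series in q^5. To stay with power series,
    [E^k] is carried along with q^(4k) = q^(5k) / q^k; surplus powers of q and factors with constant
    term 1 are cancelled at the end. Since 25n+22 = 5(5n+4)+2, the relation concerns section 4 of
    section 2 of [E^22]. Times E(q^5)^2, the inner section is a combination of E^24, E^18, E^12 and
    1 over series in q^5, so the outer one needs the recurrence at 24, 18 and 12. The quintic then
    expresses q E(q^5)^6 through E and q E(q^25), and no further relation between these two is
    required. Because 5 does not divide 22, the fifth roots of unity are not in F_23; the
    coefficients are taken in its algebraic closure, where the vanishing of an integer still means
    divisibility by 23. *)

Definition fps (R : Type) := nat -> R.

HB.instance Definition _ (R : Type) := gen_eqMixin (fps R).
HB.instance Definition _ (R : Type) := gen_choiceMixin (fps R).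

(** * The ring of formal power series *)

Section PowerSeriesRing.
Variable R : comNzRingType.
Implicit Types f g h : fps R.

Lemma fpsP f g : (forall n, f n = g n) -> f = g.
Proof. exact: functional_extensionality_dep. Qed.

Definition fps0 : fps R := fun=> 0.
Definition fps1 : fps R := fun n => (n == 0%N)%:R.
Definition fps_add f g : fps R := fun n => f n + g n.
Definition fps_opp f : fps R := fun n => - f n.
Definition fps_mul f g : fps R := fun n => \sum_(i < n.+1) f i * g (n - i)%N.

Fact fps_addA : associative fps_add.
Proof. by move=> f g h; apply: fpsP => n; apply: addrA. Qed.
Fact fps_addC : commutative fps_add.
Proof. by move=> f g; apply: fpsP => n; apply: addrC. Qed.
Fact fps_add0 : left_id fps0 fps_add.
Proof. by move=> f; apply: fpsP => n; apply: add0r. Qed.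
Fact fps_addN : left_inverse fps0 fps_opp fps_add.
Proof. by move=> f; apply: fpsP => n; apply: addNr. Qed.

HB.instance Definition _ :=
  GRing.isZmodule.Build (fps R) fps_addA fps_addC fps_add0 fps_addN.

Definition trunc N f : {poly R} := \poly_(i < N) f i.

Lemma coef_mul_lt (p p' r r' : {poly R}) n :
    (forall i, (i <= n)%N -> p`_i = p'`_i) ->
    (forall i, (i <= n)%N -> r`_i = r'`_i) -> (p * r)`_n = (p' * r')`_n.
Proof.
move=> ep er; rewrite !coefM; apply: eq_bigr => -[i /= ltin] _.
by rewrite ep ?er ?leq_subr // -ltnS.
Qed.

(** A coefficient of a product only sees finitely many coefficients of the factors, so associativity
    and commutativity are inherited from [{poly R}]. *)
Lemma fps_mulE N n f g :
  (n < N)%N -> fps_mul f g n = (trunc N f * trunc N g)`_n.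
Proof.
move=> nN; rewrite coefM; apply: eq_bigr => -[i /= ltin] _.
by rewrite !coef_poly !ifT //; lia.
Qed.

Fact fps_mulA : associative fps_mul.
Proof.
move=> f g h; apply: fpsP => n; rewrite !(@fps_mulE n.+1) //.
transitivity ((trunc n.+1 f * (trunc n.+1 g * trunc n.+1 h))`_n).
  apply: coef_mul_lt => // i lein.
  by rewrite coef_poly ltnS lein (@fps_mulE n.+1).
rewrite mulrA; apply: coef_mul_lt => // i lein.
by rewrite [RHS]coef_poly ltnS lein (@fps_mulE n.+1).
Qed.
Fact fps_mulC : commutative fps_mul.
Proof. by move=> f g; apply: fpsP => n; rewrite !(@fps_mulE n.+1) // mulrC. Qed.
Fact fps_mul1 : left_id fps1 fps_mul.
Proof.
move=> f; apply: fpsP => n; rewrite /fps_mul big_ord_recl /= /fps1 eqxx mul1r subn0.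
by rewrite big1 ?addr0 // => i _; rewrite mul0r.
Qed.
Fact fps_mulDl : left_distributive fps_mul fps_add.
Proof.
move=> f g h; apply: fpsP => n; rewrite /fps_add /fps_mul -big_split.
by apply: eq_bigr => i _; rewrite mulrDl.
Qed.
Fact fps_1neq0 : fps1 != 0 :> fps R.
Proof.
apply/eqP => /(congr1 (fun f : fps R => f 0%N)) /eqP.
by rewrite /fps1 /= oner_eq0.
Qed.

HB.instance Definition _ := GRing.Zmodule_isComNzRing.Build (fps R)
  fps_mulA fps_mulC fps_mul1 fps_mulDl fps_1neq0.

Lemma coef_fps1 n : (1 : fps R) n = (n == 0%N)%:R. Proof. by []. Qed.
Lemma coef_fpsD f g n : (f + g) n = f n + g n. Proof. by []. Qed.
Lemma coef_fpsN f n : (- f) n = - f n. Proof. by []. Qed.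
Lemma coef_fpsM f g n : (f * g) n = \sum_(i < n.+1) f i * g (n - i)%N.
Proof. by []. Qed.
Lemma coef_fps_sum I (r : seq I) (P : pred I) (F : I -> fps R) n :
  (\sum_(i <- r | P i) F i) n = \sum_(i <- r | P i) F i n.
Proof. by elim/big_rec2: _ => // i u v _ <-. Qed.
Definition fpsC (c : R) : fps R := fun n => if n == 0%N then c else 0.
Lemma coef_fpsCM c f n : (fpsC c * f) n = c * f n.
Proof.
rewrite coef_fpsM big_ord_recl /= subn0 big1 ?addr0 // => i _.
by rewrite /fpsC /= mul0r.
Qed.

Fact fpsC_is_zmod_morphism : zmod_morphism fpsC.
Proof. by move=> c d; apply: fpsP => n; rewrite coef_fpsD coef_fpsN /fpsC; case: eqP; rewrite ?subr0. Qed.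
Fact fpsC_is_monoid_morphism : monoid_morphism fpsC.
Proof.
split=> [|c d]; first by apply: fpsP => -[].
by apply: fpsP => n; rewrite coef_fpsCM /fpsC; case: eqP => // _; rewrite mulr0.
Qed.
HB.instance Definition _ :=
  GRing.isZmodMorphism.Build _ _ fpsC fpsC_is_zmod_morphism.
HB.instance Definition _ :=
  GRing.isMonoidMorphism.Build _ _ fpsC fpsC_is_monoid_morphism.

Definition fpsX : fps R := fun n => (n == 1%N)%:R.

Lemma coef_fpsXnM k f n :
  (fpsX ^+ k * f) n = if (k <= n)%N then f (n - k)%N else 0.
Proof.
elim: k n => [|k IH] n; first by rewrite expr0 mul1r subn0.
rewrite exprS -mulrA coef_fpsM; case: n => [|n].
  by rewrite big_ord_recl big_ord0 {1}/fpsX /= mul0r addr0.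
rewrite 2!big_ord_recl big1 => [|i _]; last by rewrite {1}/fpsX /= mul0r.
by rewrite {1 2}/fpsX /= mul0r add0r addr0 mul1r subn1 IH subSS.
Qed.

Lemma coef_fpsXn k n : (fpsX ^+ k : fps R) n = (n == k)%:R.
Proof.
rewrite -[_ ^+ _]mulr1 coef_fpsXnM coef_fps1.
by case: (ltngtP k n) => // [kn|->]; rewrite ?subnn // subn_eq0 leqNgt kn.
Qed.

(** Substitute for negative powers of q: identities are proved after multiplication by a power of q,
    which is then cancelled. It holds over any coefficient ring, as multiplication is a shift. *)
Lemma fpsX_lreg k : injective (fun f => fpsX ^+ k * f).
Proof.
move=> f g /= efg; apply: fpsP => n.
by have := congr1 (fun f : fps R => f (n + k)%N) efg; rewrite !coef_fpsXnM leq_addl addnK.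
Qed.

End PowerSeriesRing.

Arguments fpsX {R}.

(** * Congruence modulo powers of q, substitutions, infinite products *)

Section Truncation.
Variable R : comNzRingType.
Implicit Types f g h : fps R.

Definition eqmodX N f g := forall n, (n < N)%N -> f n = g n.

Lemma eqmodX_refl N f : eqmodX N f f. Proof. by []. Qed.
Lemma eqmodX_sym N f g : eqmodX N f g -> eqmodX N g f.
Proof. by move=> e n /e. Qed.
Lemma eqmodX_trans N f g h : eqmodX N f g -> eqmodX N g h -> eqmodX N f h.
Proof. by move=> e e' n nN; rewrite e ?e'. Qed.
Lemma eqmodX_leq M N f g : (M <= N)%N -> eqmodX N f g -> eqmodX M f g.
Proof. by move=> MN e n nM; apply: e; apply: leq_trans MN. Qed.
Lemma eqmodX_eq f g : (forall N, eqmodX N f g) -> f = g.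
Proof. by move=> e; apply: fpsP => n; apply: (e n.+1). Qed.
Lemma eqmodXD N f f' g g' :
  eqmodX N f f' -> eqmodX N g g' -> eqmodX N (f + g) (f' + g').
Proof. by move=> e e' n nN; rewrite !coef_fpsD e ?e'. Qed.
Lemma eqmodXM N f f' g g' :
  eqmodX N f f' -> eqmodX N g g' -> eqmodX N (f * g) (f' * g').
Proof.
move=> e e' n nN; rewrite !coef_fpsM; apply: eq_bigr => -[i /= le_in] _.
by rewrite (e i) 1?(e' (n - i)%N) //; lia.
Qed.
Lemma eqmodX_XnM N k f g :
  eqmodX N f g -> eqmodX (k + N) (fpsX ^+ k * f) (fpsX ^+ k * g).
Proof.
by move=> e n nN; rewrite !coef_fpsXnM; case: ifP => // kn; apply: e; lia.
Qed.
(** Coefficient n of [f * g] is [g n] plus terms in lower coefficients of [g], whence a strong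
    induction. This replaces inversion of series with constant term 1. *)
Lemma eqmodX_mulI N f g h :
  f 0%N = 1 -> eqmodX N (f * g) (f * h) -> eqmodX N g h.
Proof.
move=> f0 e n; elim/ltn_ind: n => n IH nN.
have := e n nN; rewrite !coef_fpsM !big_ord_recl /= f0 !mul1r !subn0.
rewrite [in RHS](eq_bigr (fun i : 'I_n => f (lift ord0 i) * g (n - lift ord0 i)%N)) => [/addIr //|i _].
have := ltn_ord i => lt_in.
by rewrite (IH (n - lift ord0 i)%N) //= /bump /=; lia.
Qed.

Lemma fps_mulI f : f 0%N = 1 -> injective (fun g => f * g).
Proof. by move=> f0 g h e; apply: eqmodX_eq => N; apply: (eqmodX_mulI f0); rewrite e. Qed.

Lemma coef0_fpsM f g : (f * g) 0%N = f 0%N * g 0%N.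
Proof. by rewrite coef_fpsM big_ord_recl big_ord0 addr0. Qed.
Lemma coef0_fps_exp f k : f 0%N = 1 -> (f ^+ k) 0%N = 1.
Proof. by move=> f0; elim: k => // k IH; rewrite exprS coef0_fpsM f0 IH mul1r. Qed.

(* For [d = 0] this is the constant [f 0], still a ring morphism. *)
Definition dilate d f : fps R := fun n => if (d %| n)%N then f (n %/ d)%N else 0.

(** For positive [d] this is the substitution of q^d for q, read off from composition of truncations
    with ['X^d]. *)
Lemma dilateM d f g : dilate d (f * g) = dilate d f * dilate d g.
Proof.
apply: fpsP => n; have [->|d_gt0] := posnP d.
  rewrite coef_fpsM big_ord_recl big1 => [|i _]; last by rewrite /dilate dvd0n mul0r.
  by case: n => [|n]; rewrite /dilate !dvd0n /= ?mulr0 addr0 ?coef0_fpsM.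
have tr h m : (m <= n)%N -> (trunc n.+1 h \Po 'X^d)`_m = dilate d h m.
  move=> mn; rewrite coef_comp_poly_Xn // /dilate; case: ifP => // _.
  by rewrite coef_poly ltnS (leq_trans (leq_div _ _)).
have -> : (dilate d f * dilate d g) n = ((trunc n.+1 f * trunc n.+1 g) \Po 'X^d)`_n.
  rewrite comp_polyM [LHS](@fps_mulE _ n.+1) //.
  by apply: coef_mul_lt => m mn; rewrite tr // coef_poly ltnS mn.
rewrite coef_comp_poly_Xn // /dilate; case: ifP => // _.
by rewrite [LHS](@fps_mulE _ n.+1) // ltnS leq_div.
Qed.

Fact dilate_is_zmod_morphism d : zmod_morphism (dilate d).
Proof.
by move=> f g; apply: fpsP => n; rewrite [RHS]coef_fpsD coef_fpsN /dilate; case: ifP; rewrite ?subr0.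
Qed.
Fact dilate_is_monoid_morphism d : monoid_morphism (dilate d).
Proof.
split; last exact: dilateM.
apply: fpsP => n; rewrite /dilate !coef_fps1; case: ifP => [/dvdnP[m ->]|].
  by case: d => [|d]; rewrite ?muln0 ?div0n // mulnK // muln_eq0 orbF.
by case: n => //; rewrite dvdn0.
Qed.
HB.instance Definition _ d :=
  GRing.isZmodMorphism.Build _ _ (dilate d) (dilate_is_zmod_morphism d).
HB.instance Definition _ d :=
  GRing.isMonoidMorphism.Build _ _ (dilate d) (dilate_is_monoid_morphism d).

Lemma dilateX d : (0 < d)%N -> dilate d fpsX = fpsX ^+ d.
Proof.
move=> d0; apply: fpsP => n; rewrite coef_fpsXn /dilate /fpsX.
case: ifP => [/dvdnP[m ->]|]; first by rewrite mulnK // -{2}[d]mul1n eqn_pmul2r.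
by case: eqP => // ->; rewrite dvdnn.
Qed.
Lemma dilate_eqmodX d N f g : eqmodX N f g -> eqmodX N (dilate d f) (dilate d g).
Proof.
move=> e n nN; rewrite /dilate; case: ifP => // _; apply: e.
exact: leq_ltn_trans (leq_div _ _) nN.
Qed.
Lemma coef_dilate d f n : (0 < d)%N -> dilate d f (d * n)%N = f n.
Proof. by move=> d0; rewrite /dilate dvdn_mulr // mulKn. Qed.

(** Substitution of z q for q; when z is a fifth root of unity these are the conjugates that enter
    the norm. *)
Definition rescale (z : R) f : fps R := fun n => z ^+ n * f n.
Fact rescale_is_zmod_morphism z : zmod_morphism (rescale z).
Proof. by move=> f g; apply: fpsP => n; apply: mulrBr. Qed.
Fact rescale_is_monoid_morphism z : monoid_morphism (rescale z).
Proof.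
split; first by apply: fpsP => -[|n]; rewrite /rescale ?mulr1 ?mulr0.
move=> f g; apply: fpsP => n; rewrite /rescale !coef_fpsM big_distrr /=.
apply: eq_bigr => -[i /= ltin] _; rewrite mulrACA -exprD subnKC //; lia.
Qed.
HB.instance Definition _ z :=
  GRing.isZmodMorphism.Build _ _ (rescale z) (rescale_is_zmod_morphism z).
HB.instance Definition _ z :=
  GRing.isMonoidMorphism.Build _ _ (rescale z) (rescale_is_monoid_morphism z).
Lemma rescaleX z : rescale z fpsX = fpsC z * fpsX.
Proof.
apply: fpsP => n; rewrite coef_fpsCM /rescale /fpsX.
by case: eqP => [->|]; rewrite ?mulr0.
Qed.
Lemma rescale_dilate z d f : z ^+ d = 1 -> rescale z (dilate d f) = dilate d f.
Proof.
move=> zd; apply: fpsP => n; rewrite /rescale /dilate; case: ifP => [|_]; last by rewrite mulr0.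
by case/dvdnP=> m ->; rewrite mulnC exprM zd expr1n mul1r.
Qed.
Lemma rescale_eqmodX z N f g : eqmodX N f g -> eqmodX N (rescale z f) (rescale z g).
Proof. by move=> e n nN; rewrite /rescale e. Qed.

(** Infinite product without limits: under [prodable], the factors of index at least n are 1 modulo
    q^(n+1), so the first n factors settle coefficient n. *)
Definition iprod (F : nat -> fps R) : fps R := fun n => (\prod_(i < n) F i) n.
Definition prodable (F : nat -> fps R) := forall i, eqmodX i.+1 (F i) 1.

Lemma iprodE F N : prodable F -> eqmodX N.+1 (iprod F) (\prod_(i < N) F i).
Proof.
move=> Fok n; rewrite ltnS /iprod => /subnKC <-.
elim: (N - n)%N => [|m IH]; first by rewrite addn0.
rewrite IH addnS big_ord_recr /=; apply/esym.
rewrite -[in RHS](mulr1 (\prod_(i < n + m) _)).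
by apply: (@eqmodXM n.+1) => //; apply: eqmodX_leq (Fok _); lia.
Qed.

Lemma eq_iprod F G : F =1 G -> iprod F = iprod G.
Proof. by move=> e; apply: fpsP => n; rewrite /iprod (eq_bigr _ (fun i _ => e _)). Qed.

Lemma prodableM F G : prodable F -> prodable G -> prodable (fun i => F i * G i).
Proof. by move=> e e' i; rewrite -(mulr1 1); apply: eqmodXM. Qed.
Lemma prodableX F k : prodable F -> prodable (fun i => F i ^+ k).
Proof. by move=> e i; elim: k => // k IH; rewrite exprS -(mulr1 1); apply: eqmodXM. Qed.
Lemma prodable_if (P : pred nat) F :
  prodable F -> prodable (fun i => if P i then F i else 1).
Proof. by move=> e i; case: ifP. Qed.
Lemma prodable_1BX (k : nat -> nat) :
  (forall i, (i < k i)%N) -> prodable (fun i => 1 - fpsX ^+ k i).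
Proof.
by move=> ki i n ni; rewrite coef_fpsD coef_fpsN coef_fpsXn ltn_eqF ?subr0 //; apply: leq_trans (ki i).
Qed.

Lemma iprodM F G : prodable F -> prodable G ->
  iprod (fun i => F i * G i) = iprod F * iprod G.
Proof.
move=> Fok Gok; apply: eqmodX_eq => N; apply: (@eqmodX_leq _ N.+1) => //.
apply: (eqmodX_trans (iprodE (prodableM Fok Gok))); rewrite big_split /=.
by apply: eqmodX_sym; apply: eqmodXM; apply: iprodE.
Qed.
Lemma iprodX F k : prodable F -> iprod (fun i => F i ^+ k) = iprod F ^+ k.
Proof.
move=> Fok; elim: k => [|k IH].
  by apply: fpsP => n; rewrite /iprod big1.
rewrite exprS -IH -iprodM; [by apply: eq_iprod => i; rewrite exprS|done|exact: prodableX].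
Qed.
(** The condition on truncations is q-adic continuity, which lets a ring morphism pass through the
    infinite product. *)
Lemma iprod_morph (phi : {rmorphism fps R -> fps R}) F :
    (forall N f g, eqmodX N f g -> eqmodX N (phi f) (phi g)) ->
  prodable F -> iprod (fun i => phi (F i)) = phi (iprod F).
Proof.
move=> phiok Fok; apply: eqmodX_eq => N; apply: (@eqmodX_leq _ N.+1) => //.
have phiFok : prodable (fun i => phi (F i)).
  by move=> i; rewrite -(rmorph1 phi); apply: phiok.
apply: (eqmodX_trans (iprodE phiFok)); rewrite -rmorph_prod.
by apply: phiok; apply: eqmodX_sym; apply: iprodE.
Qed.
Lemma coef0_iprod F : iprod F 0%N = 1.
Proof. by rewrite /iprod big_ord0. Qed.

Definition euler c : fps R := iprod (fun i => 1 - fpsX ^+ (c * i.+1)).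

Lemma prodable_euler c : (0 < c)%N -> prodable (fun i => 1 - fpsX ^+ (c * i.+1)).
Proof. by move=> c0; apply: (@prodable_1BX (fun i => c * i.+1)%N) => i; rewrite leq_pmull. Qed.

Lemma dilate_euler d c : (0 < d)%N -> (0 < c)%N -> dilate d (euler c) = euler (d * c).
Proof.
move=> d0 c0; rewrite /euler -iprod_morph; first last.
- exact: prodable_euler.
- by move=> N f g; apply: dilate_eqmodX.
by apply: eq_iprod => i; rewrite rmorphB rmorph1 rmorphXn /= dilateX // -exprM mulnA.
Qed.

(** Indexing by all exponents, with trivial factors off the multiples of [c], lets Euler products at
    different [c] be compared factor by factor. In each block of [c] factors only the last is
    nontrivial. *)
Lemma euler_sparse c : (0 < c)%N ->
  iprod (fun i => if (c %| i.+1)%N then 1 - fpsX ^+ i.+1 else 1) = euler c.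
Proof.
case: c => // c _; apply: eqmodX_eq => N.
apply: (@eqmodX_trans _ _ (\prod_(i < N * c.+1) (if (c.+1 %| i.+1)%N then 1 - fpsX ^+ i.+1 else 1))).
  apply: (@eqmodX_leq _ (N * c.+1).+1); first by rewrite mulnS; lia.
  by apply: iprodE; apply: prodable_if; apply: (@prodable_1BX S).
suff -> : \prod_(i < N * c.+1) (if (c.+1 %| i.+1)%N then 1 - fpsX ^+ i.+1 else 1)
       = \prod_(i < N) (1 - fpsX ^+ (c.+1 * i.+1)) :> fps R.
  apply: (@eqmodX_leq _ N.+1) => //; apply: eqmodX_sym; apply: iprodE.
  exact: prodable_euler.
elim: N => [|N IH]; first by rewrite mul0n !big_ord0.
rewrite mulSn addnC big_split_ord /= IH [RHS]big_ord_recr /=; congr (_ * _).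
rewrite big_ord_recr /= big1 ?mul1r => [|[i /= ic] _].
  by rewrite -addnS -mulSnr dvdn_mull // mulnC.
by rewrite -addnS dvdn_addr ?dvdn_mull // gtnNdvd.
Qed.

End Truncation.

(** * Pentagonal number theorem and the 5-dissection of E *)

Section Pentagonal.
Variable R : comNzRingType.
Local Notation q := (fpsX : fps R).

Definition qpoch n : fps R := \prod_(i < n) (1 - q ^+ i.+1).

(** The quotient (q)_n / (q)_s for s at most n, written without division. *)
Definition qpoch_ratio n s : fps R := \prod_(s <= i < n) (1 - q ^+ i.+1).

Definition shanks_term n s : fps R :=
  (-1) ^+ s * qpoch_ratio n s * q ^+ (s * n + 'C(s.+1, 2)).

Lemma euler_eqmodX n : eqmodX n.+1 (euler R 1) (qpoch n).
Proof.
have -> : qpoch n = \prod_(i < n) (1 - q ^+ (1 * i.+1)).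
  by apply: eq_bigr => i _; rewrite mul1n.
by apply: iprodE; apply: prodable_euler.
Qed.

(** Telescoping in [s]. At [m = n] the ratio is 1 and what remains is the first of the two new
    pentagonal monomials; the second is the term [s = n+1] of the longer Shanks sum. *)
Lemma shanks_partial n m : (m <= n)%N ->
  \sum_(s < m.+1) (shanks_term n.+1 s - shanks_term n s) =
  (-1) ^+ m.+1 * qpoch_ratio n m * q ^+ (m.+1 * n.+1 + 'C(m.+1, 2)).
Proof.
have split_last k : (k <= n)%N -> qpoch_ratio n.+1 k = qpoch_ratio n k * (1 - q ^+ n.+1).
  by move=> kn; rewrite /qpoch_ratio big_nat_recr.
elim: m => [_|m IH lt_mn].
  rewrite big_ord_recl big_ord0 addr0 /shanks_term split_last // !mul0n !expr0 mul1n addn0 expr1.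
  by ring.
rewrite big_ord_recr /= IH 1?ltnW // /shanks_term split_last //.
have -> : qpoch_ratio n m = (1 - q ^+ m.+1) * qpoch_ratio n m.+1.
  by rewrite /qpoch_ratio big_ltn.
have -> : (m.+2 * n.+1 + 'C(m.+2, 2) = n.+1 + m.+1 + m.+1 * n + 'C(m.+2, 2))%N by lia.
have -> : (m.+1 * n.+1 + 'C(m.+1, 2) = m.+1 * n + 'C(m.+2, 2))%N.
  by rewrite (binS m.+1) bin1; lia.
have -> : (m.+1 * n.+1 + 'C(m.+2, 2) = m.+1 + m.+1 * n + 'C(m.+2, 2))%N by lia.
rewrite !exprD (exprS _ m.+1) (exprS _ n) (exprS _ m); ring.
Qed.

(** With j = k+1 the exponents are the pentagonal numbers j(3j-1)/2 and j(3j+1)/2, written as j^2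
    plus a binomial coefficient. *)
Definition pent_sum n : fps R :=
  1 + \sum_(k < n) (-1) ^+ k.+1 *
      (q ^+ (k.+1 * k.+1 + 'C(k.+1, 2)) + q ^+ (k.+1 * k.+1 + 'C(k.+2, 2))).

(* Shanks: a finite sum whose [s = 0] term is [qpoch n] telescopes in [n] to the
   partial pentagonal series. *)
Lemma shanks_identity n : \sum_(s < n.+1) shanks_term n s = pent_sum n.
Proof.
have rnn k : qpoch_ratio k k = 1 by rewrite /qpoch_ratio big_geq.
elim: n => [|n IH].
  rewrite /pent_sum big_ord0 addr0 big_ord_recl big_ord0 addr0 /shanks_term rnn.
  by rewrite mul0n !expr0 !mulr1.
rewrite big_ord_recr /=.
have -> : \sum_(s < n.+1) shanks_term n.+1 s =
    \sum_(s < n.+1) (shanks_term n.+1 s - shanks_term n s) + pent_sum n.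
  by rewrite -IH -big_split /=; apply: eq_bigr => i _; rewrite subrK.
rewrite shanks_partial // rnn /shanks_term rnn /pent_sum big_ord_recr /=.
rewrite (binS n.+1) bin1; ring.
Qed.

Lemma euler_pent n : eqmodX n.+1 (euler R 1) (pent_sum n).
Proof.
apply: (eqmodX_trans (@euler_eqmodX n)); rewrite -shanks_identity big_ord_recl.
rewrite -[X in eqmodX _ X _]addr0; apply: eqmodXD.
  rewrite /shanks_term expr0 mul0n mulr1 mul1r /qpoch_ratio big_mkord.
  exact: eqmodX_refl.
(* For s at least 1 the exponent s n + C(s+1, 2) exceeds n, so only the term s = 0 is visible. *)
apply: eqmodX_sym => k kn; rewrite coef_fps_sum big1 // => i _.
by rewrite /shanks_term mulrC coef_fpsXnM ifF //= binS bin1 /bump /=; nia.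
Qed.

Lemma bin2_double k : ('C(k.+1, 2) * 2 = k.+1 * k)%N.
Proof. by elim: k => // k IH; rewrite binS bin1 mulnDl IH; lia. Qed.

(** The Kronecker symbol (12/m), which gives the sign of the pentagonal term with 24n+1 = m^2. *)
Definition chi12 (m : nat) : R :=
  if (m %% 12 == 1)%N || (m %% 12 == 11)%N then 1 else
  if (m %% 12 == 5)%N || (m %% 12 == 7)%N then -1 else 0.

(** Completing the square: 24 j(3j-1)/2 + 1 = (6j-1)^2 and 24 j(3j+1)/2 + 1 = (6j+1)^2, with j =
    k+1. *)
Lemma coef_euler_sum n N : (n <= N)%N ->
  euler R 1 n = (n == 0%N)%:R +
    \sum_(k < N) (-1) ^+ k.+1 * ((24 * n + 1 == (6 * k + 5) ^ 2)%N%:R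
                               + (24 * n + 1 == (6 * k + 7) ^ 2)%N%:R).
Proof.
move=> nN; rewrite (@euler_pent N) // /pent_sum coef_fpsD coef_fps1.
congr (_ + _); rewrite coef_fps_sum; apply: eq_bigr => k _.
have -> : (-1) ^+ k.+1 = fpsC ((-1) ^+ k.+1) :> fps R.
  by rewrite rmorphXn /= rmorphN1.
have -> : (24 * n + 1 == (6 * k + 5) ^ 2)%N = (n == k.+1 * k.+1 + 'C(k.+1, 2))%N.
  have := bin2_double k; move: (nat_of_ord k) => j b2.
  by apply/idP/idP => /eqP h; apply/eqP; nia.
have -> : (24 * n + 1 == (6 * k + 7) ^ 2)%N = (n == k.+1 * k.+1 + 'C(k.+2, 2))%N.
  have := bin2_double k.+1; move: (nat_of_ord k) => j b2.
  by apply/idP/idP => /eqP h; apply/eqP; nia.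
by rewrite coef_fpsCM coef_fpsD !coef_fpsXn.
Qed.

Lemma chi12_pm (k : nat) :
  chi12 (6 * k + 5) = (-1) ^+ k.+1 /\ chi12 (6 * k + 7) = (-1) ^+ k.+1.
Proof.
rewrite -signr_odd /= /chi12; have := odd_double_half k.
case: (odd k) => /= <-; rewrite ?expr0 ?expr1.
- have -> : ((6 * (1 + k./2.*2) + 5) %% 12 = 11)%N by lia.
  by have -> : ((6 * (1 + k./2.*2) + 7) %% 12 = 1)%N by lia.
- have -> : ((6 * (0 + k./2.*2) + 5) %% 12 = 5)%N by lia.
  by have -> : ((6 * (0 + k./2.*2) + 7) %% 12 = 7)%N by lia.
Qed.

Lemma coef_euler_nonsquare n :
  (forall m, m ^ 2 <> 24 * n + 1)%N -> euler R 1 n = 0.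
Proof.
move=> nsq; rewrite (@coef_euler_sum n n) // big1 => [|k _].
  by case: eqP => [n0|]; rewrite ?addr0 //; case: (nsq 1%N); rewrite n0.
by rewrite !(introF eqP) ?addr0 ?mulr0 // => /esym; apply: nsq.
Qed.

Lemma coef_euler_square n m : (m ^ 2 = 24 * n + 1)%N -> euler R 1 n = chi12 m.
Proof.
move=> msq; rewrite (@coef_euler_sum n n) //.
have sqE j : (24 * n + 1 == j ^ 2)%N = (j == m) by rewrite -msq eq_sym eqn_sqr.
under eq_bigr do rewrite !sqE.
have [n0|n_gt0] := posnP n.
  by rewrite n0 big_ord0 addr0 (_ : m = 1%N) //; nia.
rewrite /= mulr0n add0r.
have mmod : (m %% 6 = 1)%N \/ (m %% 6 = 5)%N.
  have h : (m ^ 2 %% 6 = 1)%N by rewrite msq; lia.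
  have := ltn_pmod m (isT : 0 < 6)%N; move: h; rewrite -modnXm.
  by case: (m %% 6)%N => [|[|[|[|[|[|]]]]]] //; auto.
have m_gt1 : (1 < m)%N by nia.
have [k [kn mE]] : exists k, (k < n)%N /\ (m = 6 * k + 5 \/ m = 6 * k + 7)%N.
  have mlt : (m <= 6 * n)%N by nia.
  case: mmod => h; [exists (m %/ 6).-1 | exists (m %/ 6)%N]; lia.
rewrite (bigD1 (Ordinal kn)) //= big1 => [|i /eqP ik].
  have [c5 c7] := chi12_pm k.
  case: mE => ->; rewrite ?c5 ?c7 !eqn_add2l ?eqxx ?(introF eqP) ?addr0 ?add0r ?mulr1 //; lia.
have ik' : (i : nat) <> k by move=> e; apply: ik; apply: val_inj.
rewrite !(introF eqP) ?addr0 ?mulr0 //; lia.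
Qed.

Lemma mod5_sqr m : (m ^ 2 %% 5 \in [:: 0; 1; 4])%N.
Proof.
by rewrite -modnXm; have := ltn_pmod m (isT : 0 < 5)%N; case: (m %% 5)%N => [|[|[|[|[|]]]]].
Qed.

(** Here 24n+1 is 3 or 2 modulo 5, hence not a square. *)
Lemma coef_euler_mod5_34 n : (n %% 5 = 3 \/ n %% 5 = 4)%N -> euler R 1 n = 0.
Proof.
move=> n34; apply: coef_euler_nonsquare => m msq; have := mod5_sqr m.
rewrite msq !inE; lia.
Qed.

Lemma chi12_5 m : chi12 (5 * m) = - chi12 m.
Proof.
rewrite /chi12 -(modnMmr 5 m); have := ltn_pmod m (isT : 0 < 12)%N.
by case: (m %% 12)%N => [|[|[|[|[|[|[|[|[|[|[|[|]]]]]]]]]]]] //= _; rewrite ?oppr0 ?opprK.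
Qed.

Lemma dvd5_sqr m : (5 %| m ^ 2)%N -> (5 %| m)%N.
Proof. by rewrite Euclid_dvdX // andbT. Qed.

(** Now 24(5n+1)+1 = 5(24n+5) is a square only if it is 25 j^2, which forces n = 5k and j^2 = 24k+1;
    the sign is (12/5) = -1. *)
Lemma coef_euler_mod5_1 n : euler R 1 (5 * n + 1)%N = - dilate 5 (euler R 1) n.
Proof.
rewrite /dilate; case: ifP => [/dvdnP[k ->]|ndv].
  rewrite mulnK //.
  have [[m msq]|nsq] := pselect (exists m, m ^ 2 = 24 * k + 1)%N.
    rewrite (@coef_euler_square _ (5 * m)%N) ?(coef_euler_square msq) ?chi12_5 //.
    by rewrite expnMn msq; lia.
  rewrite !coef_euler_nonsquare ?oppr0 // => m msq; apply: nsq; first by exists m.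
  have /dvdnP[j mE] : (5 %| m)%N by apply: dvd5_sqr; rewrite msq; lia.
  by exists j; move: msq; rewrite mE expnMn; lia.
rewrite oppr0; apply: coef_euler_nonsquare => m msq; move/negP: ndv; apply.
have /dvdnP[j mE] : (5 %| m)%N by apply: dvd5_sqr; rewrite msq; lia.
by move: msq; rewrite mE expnMn; lia.
Qed.

(** For [r = 0] this is Atkin's operator U_5. *)
Definition section5 r (f : fps R) : fps R := fun n => f (5 * n + r)%N.

Lemma dilate5E (f : fps R) m r : (r < 5)%N ->
  dilate 5 f (m * 5 + r)%N = if r == 0%N then f m else 0.
Proof.
move=> r5; rewrite /dilate dvdn_addr ?dvdn_mull //.
by case: r r5 => [|[|[|[|[|]]]]] //= _; rewrite ?addn0 ?mulnK.
Qed.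

Lemma euler_dissection :
  euler R 1 = dilate 5 (section5 0 (euler R 1)) - q * dilate 25 (euler R 1)
              + q ^+ 2 * dilate 5 (section5 2 (euler R 1)).
Proof.
have -> : dilate 25 (euler R 1) = dilate 5 (dilate 5 (euler R 1)).
  by rewrite !dilate_euler.
have -> : q * dilate 5 (dilate 5 (euler R 1)) = q ^+ 1 * dilate 5 (dilate 5 (euler R 1)).
  by rewrite expr1.
apply: fpsP => n; rewrite !coef_fpsD coef_fpsN !coef_fpsXnM (divn_eq n 5).
have := ltn_pmod n (isT : 0 < 5)%N; move: (n %/ 5)%N (n %% 5)%N => m r.
case: r => [|[|[|[|[|]]]]] // _; rewrite !dilate5E //=.
- rewrite !addn0; case: m => [|m]; first by rewrite /section5 !muln0 /=; ring.
  rewrite (_ : (0 < _)%N = true) // (_ : (1 < _)%N = true) //.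
  rewrite (_ : m.+1 * 5 - 1 = m * 5 + 4)%N; last lia.
  rewrite (_ : m.+1 * 5 - 2 = m * 5 + 3)%N; last lia.
  by rewrite !dilate5E // /section5 addn0 mulnC subr0 addr0.
- rewrite (@ifT _ (0 < _)%N); last lia.
  rewrite (_ : m * 5 + 1 - 1 = m * 5 + 0)%N; last lia.
  rewrite dilate5E //= mulnC coef_euler_mod5_1 add0r.
  case: ifP => [le|_]; last by rewrite addr0.
  rewrite (_ : 5 * m + 1 - 2 = m.-1 * 5 + 4)%N; last lia.
  by rewrite dilate5E // addr0.
- rewrite (@ifT _ (0 < _)%N) ?(@ifT _ (1 < _)%N); [|lia..].
  rewrite (_ : m * 5 + 2 - 1 = m * 5 + 1)%N; last lia.
  rewrite (_ : m * 5 + 2 - 2 = m * 5 + 0)%N; last lia.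
  by rewrite !dilate5E //= oppr0 !add0r /section5 mulnC.
- rewrite coef_euler_mod5_34; last lia.
  rewrite (@ifT _ (0 < _)%N) ?(@ifT _ (1 < _)%N); [|lia..].
  rewrite (_ : m * 5 + 3 - 1 = m * 5 + 2)%N; last lia.
  rewrite (_ : m * 5 + 3 - 2 = m * 5 + 1)%N; last lia.
  by rewrite !dilate5E //= oppr0 !add0r.
- rewrite coef_euler_mod5_34; last lia.
  rewrite (@ifT _ (0 < _)%N) ?(@ifT _ (1 < _)%N); [|lia..].
  rewrite (_ : m * 5 + 4 - 1 = m * 5 + 3)%N; last lia.
  rewrite (_ : m * 5 + 4 - 2 = m * 5 + 2)%N; last lia.
  by rewrite !dilate5E //= oppr0 !add0r.
Qed.

End Pentagonal.

(** * Vanishing coefficients of E^3, from a finite form of Jacobi's identity *)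

Section Jacobi.
Variable R : comNzRingType.
Local Notation q := (fpsX : fps R).
Local Notation qpoch := (qpoch R).

(** Gaussian binomial coefficients, by the q-Pascal rule so that no quotient of [qpoch] is
    formed. *)
Fixpoint gauss m j : fps R :=
  match m, j with
  | _, 0 => 1
  | 0, _.+1 => 0
  | m'.+1, j'.+1 => gauss m' j'.+1 + q ^+ (m' - j') * gauss m' j'
  end.

Lemma gauss0 m : gauss m 0 = 1. Proof. by case: m. Qed.
Lemma gaussS m j :
  gauss m.+1 j.+1 = gauss m j.+1 + q ^+ (m - j) * gauss m j.
Proof. by []. Qed.
Lemma gauss_small m j : (m < j)%N -> gauss m j = 0.
Proof.
elim: m j => [|m IH] [|j] //; rewrite ltnS => mj.
by rewrite gaussS !IH ?mulr0 ?addr0 // ltnW.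
Qed.
Lemma qpochS n : qpoch n.+1 = qpoch n * (1 - q ^+ n.+1).
Proof. by rewrite /qpoch big_ord_recr. Qed.
Lemma qpoch0 : qpoch 0 = 1. Proof. exact: big_ord0. Qed.

Lemma gauss_qpoch m j : (j <= m)%N ->
  gauss m j * qpoch j * qpoch (m - j) = qpoch m.
Proof.
elim: m j => [|m IH] [|j] //; rewrite ?gauss0 ?qpoch0 ?mul1r ?subn0 //.
rewrite ltnS => jm; rewrite gaussS subSS [RHS]qpochS.
have e1 : gauss m j * qpoch j * qpoch (m - j) = qpoch m by apply: IH.
have e2 : gauss m j.+1 * qpoch j.+1 * qpoch (m - j) = qpoch m * (1 - q ^+ (m - j)).
  have [lt_jm|le_mj] := ltnP j m.
    have -> : (m - j = (m - j.+1).+1)%N by lia.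
    by rewrite -(IH j.+1) // [qpoch (m - j.+1).+1]qpochS mulrA.
  have -> : m = j by apply/eqP; rewrite eqn_leq le_mj jm.
  by rewrite subnn expr0 subrr mulr0 gauss_small ?mul0r.
transitivity (gauss m j.+1 * qpoch j.+1 * qpoch (m - j)
  + q ^+ (m - j) * (gauss m j * qpoch j * qpoch (m - j)) * (1 - q ^+ j.+1)).
  by rewrite qpochS; ring.
rewrite e1 e2; have -> : (m.+1 = (m - j) + j.+1)%N by lia.
by rewrite [in RHS]exprD; ring.
Qed.

(** Homogeneous q-binomial theorem, by induction with the q-Pascal rule. Keeping [u] free allows
    [u = q^n], which centres the product without negative powers of q. *)
Lemma rothe (u : fps R) m :
  \prod_(i < m) (u%:P - (q ^+ i) *: 'X) =
  \sum_(j < m.+1) ((-1) ^+ j * q ^+ 'C(j, 2) * gauss m j * u ^+ (m - j)) *: 'X^j.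
Proof.
pose c m j : fps R := (-1) ^+ j * q ^+ 'C(j, 2) * gauss m j * u ^+ (m - j).
rewrite -[RHS]/(\sum_(j < m.+1) (c m j *: 'X^j : {poly (fps R)})).
elim: m => [|m IH].
  by rewrite big_ord0 big_ord_recl big_ord0 addr0 /c /= !mul1r expr0 scale1r.
rewrite big_ord_recr /= {}IH mulrBr.
have -> : (\sum_(j < m.+1) c m j *: 'X^j) * u%:P =
    (c m 0 * u) *: ('X^0 : {poly fps R}) + \sum_(j < m.+1) (c m j.+1 * u) *: 'X^(j.+1).
  have c0 : c m m.+1 = 0 by rewrite /c gauss_small // mulr0 mul0r.
  rewrite [X in _ = _ + X]big_ord_recr /= c0 mul0r scale0r addr0.
  rewrite big_ord_recl mulrDl; congr (_ + _).
    by rewrite -scalerAl mulrC mul_polyC scalerA mulrC.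
  rewrite big_distrl; apply: eq_bigr => i _ /=.
  by rewrite -scalerAl mulrC mul_polyC scalerA.
rewrite [RHS]big_ord_recl -addrA; congr (_ + _).
  by rewrite /c !gauss0 subn0 subn0 exprSr mulrA.
rewrite big_distrl /= -sumrB; apply: eq_bigr => -[j /= jm] _.
rewrite -scalerAl -scalerAr scalerA -exprSr -scalerBl; congr (_ *: _).
rewrite /c gaussS subSS binS bin1.
have [lt_jm|le_mj] := ltnP j m.
  have -> : q ^+ m = q ^+ (m - j.+1) * q * q ^+ j.
    by rewrite -exprSr -exprD; congr (_ ^+ _); lia.
  have -> : (m - j = (m - j.+1).+1)%N by lia.
  by rewrite !exprD !exprS; ring.
have -> : m = j by apply/eqP; rewrite eqn_leq le_mj -ltnS jm.
by rewrite gauss_small // subnn !exprD !exprS !expr0; ring.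
Qed.

Lemma prod_rothe_left n :
  \prod_(i < n) (q ^+ n - q ^+ i) = (-1) ^+ n * q ^+ 'C(n, 2) * qpoch n.
Proof.
have -> : qpoch n = \prod_(i < n) (1 - q ^+ (n - i)).
  rewrite /qpoch (reindex_inj rev_ord_inj); apply: eq_bigr => -[i /= ltin] _.
  by congr (1 - q ^+ _); lia.
rewrite -triangular_sum big_mkord -prodrXr.
have -> : (-1) ^+ n = \prod_(i < n) (-1) :> fps R by rewrite prodr_const card_ord.
transitivity (\prod_(i < n) (-1 * q ^+ i * (1 - q ^+ (n - i)))); last by rewrite !big_split.
apply: eq_bigr => -[i /= ltin] _.
have {1}-> : (n = i + (n - i))%N by lia.
by rewrite exprD; ring.
Qed.

Lemma prod_rothe_right n :
  \prod_(i < n) (q ^+ n - q ^+ (n + i.+1)) = q ^+ (n * n) * qpoch n.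
Proof.
transitivity (\prod_(i < n) (q ^+ n * (1 - q ^+ i.+1))).
  by apply: eq_bigr => i _; rewrite exprD; ring.
by rewrite big_split /= prodr_const card_ord exprM.
Qed.

(** Among the indices 0..2n+1 the two central ones are n and n+1; j and 2n+1-j are equally far from
    them and receive the same triangular exponent. *)
Definition centre_dist n j := if (j <= n)%N then (n - j)%N else (j - n.+1)%N.

Lemma bin2_sqr k : ('C(k, 2) * 2 + k = k * k)%N.
Proof. by case: k => // k; rewrite bin2_double; lia. Qed.

Lemma jacobi_exponent n j : (j <= n + n.+1)%N ->
  ('C(j, 2) + n * (n + n.+1 - j) =
   n + 'C(n, 2) + n * n + 'C((centre_dist n j).+1, 2))%N.
Proof.
move=> jm; rewrite /centre_dist; have := bin2_sqr n; have := bin2_sqr j.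
case: leqP => [le_jn|lt_nj].
  have := bin2_double (n - j).
  by move: (n - j)%N (subnKC le_jn) => d <-; 
    rewrite (_ : j + d + (j + d).+1 - j = j + d.+1 + d)%N; lia.
have := bin2_double (j - n.+1).
move: (j - n.+1)%N (subnKC lt_nj) jm => d <- jm.
by rewrite (_ : n + n.+1 - (n.+1 + d) = n - d)%N; [nia|lia].
Qed.

(* Derivative at [X = 1] of Rothe's identity with [u = q ^+ n], whose factor of
   index [n] vanishes there. *)
Lemma jacobi_finite n :
  qpoch n ^+ 2 = \sum_(j < (n + n.+1).+1)
    fpsC (- (-1) ^+ n * (-1) ^+ j * j%:R) *
      (q ^+ 'C((centre_dist n j).+1, 2) * gauss (n + n.+1) j).
Proof.
set m := (n + n.+1)%N.
pose N := (n + 'C(n, 2) + n * n)%N.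
have derivE (A C B : {poly fps R}) : C.[1] = 0 ->
    ((A * (C * B))^`()).[1] = A.[1] * C^`().[1] * B.[1].
  by move=> C0; rewrite !derivM !hornerD !hornerM !hornerD !hornerM C0; ring.
have lhs : ((\prod_(i < m) ((q ^+ n)%:P - q ^+ i *: 'X))^`()).[1] =
    - (-1) ^+ n * (q ^+ N * qpoch n ^+ 2).
  rewrite big_split_ord big_ord_recl /= derivE; last by rewrite !hornerE subrr.
  rewrite derivB derivC derivZ derivX !horner_prod.
  have ev (u v : fps R) : (u%:P - v *: 'X).[1] = u - v by rewrite !hornerE.
  rewrite !(eq_bigr _ (fun i _ => ev _ _)).
  rewrite -[X in _ * X = _]/(\prod_(i < n) (q ^+ n - q ^+ (n + i.+1))).
  rewrite prod_rothe_left prod_rothe_right !hornerE /N !exprD /=; ring.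
have rhs := congr1 (fun p => (p^`()).[1]) (rothe (q ^+ n) m).
rewrite lhs raddf_sum /= horner_sum in rhs.
apply: (@fpsX_lreg R N) => /=.
rewrite -[LHS](signrMK n) -[X in _ * X]opprK mulrN -mulNr -[X in _ * X]mulNr rhs.
rewrite !big_distrr /=; apply: eq_bigr => -[j /= jm] _.
rewrite derivZ derivXn hornerZ hornerMn hornerXn expr1n -exprM.
have ej := jacobi_exponent jm; rewrite -/m -/N in ej.
transitivity (- (-1) ^+ n * (-1) ^+ j * j%:R * (q ^+ ('C(j, 2) + n * (m - j)) * gauss m j)).
  by rewrite exprD; ring.
by rewrite ej exprD !rmorphM rmorphN !rmorphXn /= rmorphN1 rmorph_nat; ring.
Qed.

(** In (q)_m / ((q)_j (q)_(m-j)) all three products agree with E up to the order min(j, m-j), so the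
    quotient is 1/E to that order. *)
Lemma euler_gauss m j : (j <= m)%N ->
  eqmodX (minn j (m - j)).+1 (euler R 1 * gauss m j) 1.
Proof.
move=> jm; set N := (minn j (m - j)).+1.
have eqE k : (N <= k.+1)%N -> eqmodX N (qpoch k) (euler R 1).
  by move=> Nk; apply: (eqmodX_leq Nk); apply: eqmodX_sym; apply: euler_eqmodX.
have E0 : euler R 1 0%N = 1 by exact: coef0_iprod.
apply: (@eqmodX_mulI _ _ (euler R 1)) => //; apply: (@eqmodX_mulI _ _ (euler R 1)) => //.
rewrite mulr1; apply: (@eqmodX_trans _ _ _ (euler R 1 * (gauss m j * qpoch j * qpoch (m - j)))).
  rewrite (_ : _ * _ = euler R 1 * (gauss m j * euler R 1 * euler R 1)); last by ring.
  by do 2!apply: eqmodXM => //; [apply: eqmodXM => //|]; apply: eqmodX_sym; apply: eqE;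
    rewrite ltnS ?geq_minl ?geq_minr.
rewrite gauss_qpoch //; apply: eqmodXM => //; apply: eqE.
by rewrite ltnS geq_min jm.
Qed.

(** E^3 is supported on triangular numbers d(d+1)/2, and d(d+1) = 4 mod 5 has no solution. *)
Lemma coef_euler_cube_mod5_2 k : (euler R 1 ^+ 3) (5 * k + 2)%N = 0.
Proof.
set n := (5 * k + 2)%N.
have -> : (euler R 1 ^+ 3) n = (euler R 1 * qpoch n ^+ 2) n.
  have e := @euler_eqmodX R n.
  by apply: (@eqmodXM _ n.+1) => //; rewrite [_ ^+ 2]expr2; apply: eqmodXM.
rewrite jacobi_finite big_distrr coef_fps_sum /=; apply: big1 => -[j /= jm] _.
set d := centre_dist n j.
have dn : (d <= n)%N by rewrite /d /centre_dist; case: ifP; lia.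
rewrite mulrCA coef_fpsCM mulrCA.
have -> : (q ^+ 'C(d.+1, 2) * (euler R 1 * gauss (n + n.+1) j)) n
        = (q ^+ 'C(d.+1, 2) * 1) n.
  (* The precision suffices because min(j, 2n+1-j) = n-d and C(d+1, 2) is at least d. *)
  apply: (eqmodX_XnM (euler_gauss _)); first lia.
  have := bin2_double d; move: dn; rewrite /d /centre_dist /minn.
  by case: ifP; case: ifP; nia.
rewrite mulr1 coef_fpsXn; case: eqP => [nE|]; last by rewrite mulr0.
have := bin2_double d; rewrite -nE /n => h.
have : ((d.+1 * d) %% 5 = 4)%N by rewrite -h; lia.
rewrite -modnMm -addn1 -modnDml; have := ltn_pmod d (isT : 0 < 5)%N.
by case: (d %% 5)%N => [|[|[|[|[|]]]]].
Qed.

End Jacobi.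

(** * Norm over the fifth roots of unity and the quintic *)

Section Dissection.
Variable R : comNzRingType.
Implicit Types f g : fps R.
Local Notation q := (fpsX : fps R).

Fact section5_is_zmod_morphism r : zmod_morphism (@section5 R r).
Proof. by []. Qed.
HB.instance Definition _ r :=
  GRing.isZmodMorphism.Build _ _ (@section5 R r) (section5_is_zmod_morphism r).

Lemma section5_XnM r k s f : s = (5 * k + r)%N -> (r < 5)%N ->
  section5 r (q ^+ s * dilate 5 f) = q ^+ k * f.
Proof.
move=> -> r5; apply: fpsP => n; rewrite /section5 !coef_fpsXnM leq_add2r leq_pmul2l //.
case: ifP => // kn; rewrite (_ : _ - _ = (n - k) * 5 + 0)%N; last lia.
by rewrite dilate5E.
Qed.

Lemma section5_XnM0 r s f : (s %% 5)%N != r -> (r < 5)%N ->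
  section5 r (q ^+ s * dilate 5 f) = 0.
Proof.
move=> sr r5; apply: fpsP => n; rewrite /section5 !coef_fpsXnM.
case: ifP => // le; rewrite /dilate ifF //; apply/negbTE/negP => /dvdnP[k kE].
by move/eqP: sr; lia.
Qed.

Lemma dilate5_inj f g : dilate 5 f = dilate 5 g -> f = g.
Proof.
by move=> e; apply: fpsP => n; rewrite -(coef_dilate f n (isT : 0 < 5)%N) e coef_dilate.
Qed.

(** Pair the factors at z, z^4 and at z^2, z^3: they involve z only through s = z + z^4 and t = z^2
    + z^3, and s + t = s t = -1 removes z from the product. *)
Lemma norm5_quadratic (z x y w : fps R)
    (a := x ^+ 2 + y ^+ 2 + w ^+ 2) (b := x * y + y * w) (c := x * w) :
    1 + z + z ^+ 2 + z ^+ 3 + z ^+ 4 = 0 ->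
  (x + y + w) * (x + z * y + z ^+ 2 * w) * (x + z ^+ 2 * y + z ^+ 4 * w)
    * (x + z ^+ 3 * y + z * w) * (x + z ^+ 4 * y + z ^+ 3 * w) =
  (x + y + w) * (a ^+ 2 - a * (b + c) - (b ^+ 2 + c ^+ 2) + 3%:R * (b * c)).
Proof.
move=> z0.
have z5 : z ^+ 5 = 1.
  have e : (z - 1) * (1 + z + z ^+ 2 + z ^+ 3 + z ^+ 4) = z ^+ 5 - 1 by ring.
  by move: e; rewrite z0 mulr0 => /esym/eqP; rewrite subr_eq0 => /eqP.
pose s := z + z ^+ 4; pose t := z ^+ 2 + z ^+ 3.
have st : s + t = -1.
  apply: (addrI 1); rewrite subrr -z0 /s /t; ring.
have st' : s * t = -1.
  rewrite -st; transitivity (z ^+ 3 + z ^+ 4 + z ^+ 5 * (z + z ^+ 2)).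
    by rewrite /s /t; ring.
  by rewrite z5 /s /t; ring.
have p1 : (x + z * y + z ^+ 2 * w) * (x + z ^+ 4 * y + z ^+ 3 * w) =
    x ^+ 2 + y ^+ 2 + w ^+ 2 + s * (x * y + y * w) + t * (x * w).
  transitivity (x ^+ 2 + z ^+ 5 * (y ^+ 2 + w ^+ 2) + (z + z ^+ 4) * (x * y)
    + (z ^+ 5 * z + z ^+ 4) * (y * w) + (z ^+ 2 + z ^+ 3) * (x * w)).
    by ring.
  by rewrite z5 /s /t; ring.
have p2 : (x + z ^+ 2 * y + z ^+ 4 * w) * (x + z ^+ 3 * y + z * w) =
    x ^+ 2 + y ^+ 2 + w ^+ 2 + t * (x * y + y * w) + s * (x * w).
  transitivity (x ^+ 2 + z ^+ 5 * (y ^+ 2 + w ^+ 2) + (z ^+ 2 + z ^+ 3) * (x * y)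
    + (z ^+ 5 * z ^+ 2 + z ^+ 3) * (y * w) + (z + z ^+ 4) * (x * w)).
    by ring.
  by rewrite z5 /s /t; ring.
transitivity ((x + y + w) * (((x + z * y + z ^+ 2 * w) * (x + z ^+ 4 * y + z ^+ 3 * w))
   * ((x + z ^+ 2 * y + z ^+ 4 * w) * (x + z ^+ 3 * y + z * w)))); first by ring.
rewrite p1 p2 -/a -/b -/c.
have -> : (a + s * b + t * c) * (a + t * b + s * c) =
    a ^+ 2 + (s + t) * (a * (b + c)) + (s * t) * (b ^+ 2 + c ^+ 2)
    + ((s + t) ^+ 2 - 2%:R * (s * t)) * (b * c) by ring.
by rewrite st st'; ring.
Qed.

Lemma norm5_trinomial (z x y w : fps R) :
    1 + z + z ^+ 2 + z ^+ 3 + z ^+ 4 = 0 -> x * w = - y ^+ 2 ->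
  (x + y + w) * (x + z * y + z ^+ 2 * w) * (x + z ^+ 2 * y + z ^+ 4 * w)
    * (x + z ^+ 3 * y + z * w) * (x + z ^+ 4 * y + z ^+ 3 * w) =
  x ^+ 5 + 11%:R * y ^+ 5 + w ^+ 5.
Proof.
move=> z0 xw; rewrite norm5_quadratic //.
(* The second factor is the quotient of the difference of both sides by [x * w + y ^+ 2]. *)
transitivity (x ^+ 5 + 11%:R * y ^+ 5 + w ^+ 5
  + (x * w + y ^+ 2) * (5%:R * (x * y * w) - 10%:R * y ^+ 3)); first by ring.
by rewrite xw addNr mul0r addr0.
Qed.

Lemma quintic_trinomial (x y w : fps R) (e := x + y + w) : x * w = - y ^+ 2 ->
  e ^+ 5 = 5%:R * (y * e ^+ 4) - 15%:R * (y ^+ 2 * e ^+ 3) + 25%:R * (y ^+ 3 * e ^+ 2)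
    - 25%:R * (y ^+ 4 * e) + (x ^+ 5 + 11%:R * y ^+ 5 + w ^+ 5).
Proof.
move=> xw; apply/eqP; rewrite -subr_eq0; apply/eqP.
transitivity ((x * w + y ^+ 2) * (5%:R * x ^+ 3 + 10%:R * (x ^+ 2 * w) + 5%:R * (x * y ^+ 2)
  + 10%:R * (x * w ^+ 2) + 5%:R * (y ^+ 2 * w) + 5%:R * w ^+ 3)); first by rewrite /e; ring.
by rewrite xw addNr mul0r.
Qed.

(** If 5 divides n every conjugate equals F; otherwise i -> i n permutes the residues modulo 5 and
    the product is cyclotomic. *)
Lemma norm5_1BX (z : R) n : 1 + z + z ^+ 2 + z ^+ 3 + z ^+ 4 = 0 ->
  let F : fps R := 1 - q ^+ n in
  F * rescale z F * rescale (z ^+ 2) F * rescale (z ^+ 3) F * rescale (z ^+ 4) F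
  = if (5 %| n)%N then (1 - q ^+ n) ^+ 5 else 1 - q ^+ (5 * n).
Proof.
move=> z0 F.
have z5 : z ^+ 5 = 1.
  have e : (z - 1) * (1 + z + z ^+ 2 + z ^+ 3 + z ^+ 4) = z ^+ 5 - 1 by ring.
  by move: e; rewrite z0 mulr0 => /esym/eqP; rewrite subr_eq0 => /eqP.
have rF k : rescale (z ^+ k) F = 1 - fpsC (z ^+ (k * n %% 5)) * q ^+ n.
  rewrite rmorphB rmorph1 rmorphXn /= rescaleX exprMn -rmorphXn -exprM; congr (1 - fpsC _ * _).
  by rewrite {1}(divn_eq (k * n) 5) exprD mulnC exprM z5 expr1n mul1r.
rewrite -[z in rescale z F]expr1 !rF.
pose Z : fps R := fpsC z; set t := q ^+ n.
have Z0 : 1 + Z + Z ^+ 2 + Z ^+ 3 + Z ^+ 4 = 0.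
  by rewrite /Z -!rmorphXn -(rmorph1 (@fpsC R)) -!rmorphD z0 rmorph0.
have cyc : (1 - t) * (1 - Z * t) * (1 - Z ^+ 2 * t) * (1 - Z ^+ 3 * t) * (1 - Z ^+ 4 * t)
    = 1 - t ^+ 5.
  (* The cyclotomic product is the norm of the binomial with x = 1, y = -t, w = 0. *)
  have := @norm5_quadratic Z 1 (- t) 0 Z0; rewrite !mulr0 !addr0 !mulrN => ->.
  by ring.
rewrite [(5 * n)%N]mulnC exprM -/t !rmorphXn /= -/Z mul1n -!(modnMmr _ n).
have := ltn_pmod n (isT : 0 < 5)%N; rewrite /dvdn.
case: (n %% 5)%N => [|[|[|[|[|]]]]] //= _; rewrite -?cyc;
  repeat match goal with |- context [modn ?k 5] =>
    let v := eval compute in (modn k 5) in change (modn k 5) with v end;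
  rewrite /F -/t; by ring.
Qed.

Definition norm5 (z : R) f :=
  f * rescale z f * rescale (z ^+ 2) f * rescale (z ^+ 3) f * rescale (z ^+ 4) f.

(** In the norm, the indices divisible by 5 contribute E(q^5)^5, and the others E(q^5) without its
    factors at multiples of 25, which E(q^25) restores. *)
Lemma norm5_euler (z : R) : 1 + z + z ^+ 2 + z ^+ 3 + z ^+ 4 = 0 ->
  norm5 z (euler R 1) * euler R 25 = euler R 5 ^+ 6.
Proof.
move=> z0; pose F i : fps R := 1 - q ^+ i.+1.
have Fok : prodable F by apply: (@prodable_1BX _ S).
have eulerF : euler R 1 = iprod F by apply: eq_iprod => i; rewrite mul1n.
have rok k : prodable (fun i => rescale (z ^+ k) (F i)).
  by move=> i; rewrite -(rmorph1 (rescale (z ^+ k))); apply: rescale_eqmodX.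
have rE k : iprod (fun i => rescale (z ^+ k) (F i)) = rescale (z ^+ k) (iprod F).
  by apply: iprod_morph => // N f g; apply: rescale_eqmodX.
have normE : norm5 z (euler R 1) =
    iprod (fun i => if (5 %| i.+1)%N then (1 - q ^+ i.+1) ^+ 5 else 1 - q ^+ (5 * i.+1)).
  rewrite eulerF /norm5 -[z in rescale z _]expr1 -!rE -!iprodM; try by do ?apply: prodableM.
  by apply: eq_iprod => i; rewrite expr1 norm5_1BX.
have E5ok := prodable_euler R (isT : 0 < 5)%N.
have E25 : euler R 25 = iprod (fun i => if (5 %| i.+1)%N then 1 - q ^+ (5 * i.+1) else 1).
  rewrite -(@dilate_euler _ 5 5) // -(@euler_sparse _ 5) // -iprod_morph.
  - apply: eq_iprod => i; case: ifP => _; rewrite ?rmorph1 //.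
    by rewrite rmorphB rmorph1 rmorphXn /= dilateX // -exprM.
  - by move=> N f g; apply: dilate_eqmodX.
  by apply: prodable_if.
have spok := prodable_if (fun i => 5 %| i.+1)%N Fok.
rewrite normE E25 -iprodM; first last.
- exact: prodable_if.
- by move=> i; case: ifP => _; [apply: (prodableX 5 Fok)|apply: E5ok].
rewrite exprS -{2}(@euler_sparse _ 5) // -iprodX // -iprodM //; last exact: prodableX.
apply: eq_iprod => i; case: ifP => _; rewrite ?expr1n; ring.
Qed.

End Dissection.

(** * The quintic equation of E and its constant term *)

Section EulerRelations.
Variable K : fieldType.
Hypothesis K3 : 3%:R != 0 :> K.
Variable z : K.
Hypothesis z0 : 1 + z + z ^+ 2 + z ^+ 3 + z ^+ 4 = 0.
Local Notation q := (fpsX : fps K).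
Local Notation E := (euler K 1).
Local Notation T := (euler K 5).
Local Notation b := (euler K 25).
Local Notation A := (section5 0 E).
Local Notation C := (section5 2 E).

(** In the expansion of E^3 the class 2 mod 5 is 3 x (x w + y^2), and it vanishes; 3 is a unit and
    the section [A] has constant term 1, so both cancel. *)
Lemma euler_sections : A * C = - T ^+ 2.
Proof.
have -> : T = dilate 5 E by rewrite dilate_euler.
have := euler_dissection K; set a := section5 0 _; set c := section5 2 _.
have -> : dilate 25 E = dilate 5 (dilate 5 E) by rewrite !dilate_euler.
set u := dilate 5 E => ed.
have cube : E ^+ 3 = q ^+ 0 * dilate 5 (a ^+ 3) - q ^+ 1 * dilate 5 (3%:R * a ^+ 2 * u)
    + q ^+ 2 * dilate 5 (3%:R * (a * (a * c + u ^+ 2)))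
    - q ^+ 3 * dilate 5 (u ^+ 3 + 6%:R * (a * u * c))
    + q ^+ 4 * dilate 5 (3%:R * (a * c ^+ 2) + 3%:R * (u ^+ 2 * c))
    - q ^+ 5 * dilate 5 (3%:R * u * c ^+ 2) + q ^+ 6 * dilate 5 (c ^+ 3).
  by rewrite ed; ring.
have : section5 2 (E ^+ 3) = 0 by apply: fpsP => n; apply: coef_euler_cube_mod5_2.
rewrite cube !(raddfD (@section5 K 2), raddfN (@section5 K 2)) /= (@section5_XnM _ _ 0 2) //.
rewrite !section5_XnM0 // !(oppr0, addr0, add0r) mul1r => e.
have e0 : a * (a * c + u ^+ 2) = a * 0.
  rewrite mulr0; apply: fpsP => n; have := congr1 (fun f : fps K => f n) e.
  by rewrite -(rmorph_nat (@fpsC K)) /= coef_fpsCM => /eqP; rewrite mulf_eq0 (negbTE K3) => /eqP.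
have a0 : a 0%N = 1 by exact: coef0_iprod.
by apply/eqP; rewrite -addr_eq0; apply/eqP; apply: (fps_mulI a0).
Qed.

(* The dilation by 5 of this series is the constant term of the quintic
   equation of [E], i.e. the norm of [E] over the fifth roots of unity. *)
Definition quintic_const : fps K := A ^+ 5 - 11%:R * (q * T ^+ 5) + q ^+ 2 * C ^+ 5.

Let y : fps K := - q * b.
Let x : fps K := dilate 5 A.
Let w : fps K := q ^+ 2 * dilate 5 C.

Lemma euler_xyw : E = x + y + w.
Proof. by rewrite {1}euler_dissection /x /y /w mulNr dilate_euler. Qed.

Lemma euler_xw : x * w = - y ^+ 2.
Proof.
have -> : x * w = q ^+ 2 * dilate 5 (A * C) by rewrite /x /w; ring.
by rewrite euler_sections rmorphN rmorphXn /= dilate_euler // /y; ring.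
Qed.

Lemma dilate_quintic_const : dilate 5 quintic_const = x ^+ 5 + 11%:R * y ^+ 5 + w ^+ 5.
Proof.
have bE : b = dilate 5 T by rewrite dilate_euler.
transitivity (x ^+ 5 - 11%:R * (dilate 5 q * dilate 5 T ^+ 5)
  + dilate 5 q ^+ 2 * dilate 5 C ^+ 5); first by rewrite /quintic_const /x; ring.
by rewrite dilateX // /y /w bE; ring.
Qed.

(** Proved after substituting q^5 for q, where the left factor becomes the norm of E: q -> z^k q
    fixes series in q^5 and multiplies y by z^k and w by z^(2k). *)
Lemma quintic_const_mul : quintic_const * T = E ^+ 6.
Proof.
have bE : b = dilate 5 T by rewrite dilate_euler.
have TE : T = dilate 5 E by rewrite dilate_euler.
apply: dilate5_inj; transitivity (dilate 5 quintic_const * b); first by rewrite bE rmorphM.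
transitivity (T ^+ 6); last by rewrite TE rmorphXn.
rewrite -(norm5_euler z0); congr (_ * _); have z5 : z ^+ 5 = 1.
  have e : (z - 1) * (1 + z + z ^+ 2 + z ^+ 3 + z ^+ 4) = z ^+ 5 - 1 by ring.
  by move: e; rewrite z0 mulr0 => /esym/eqP; rewrite subr_eq0 => /eqP.
have Z0 : 1 + fpsC z + fpsC z ^+ 2 + fpsC z ^+ 3 + fpsC z ^+ 4 = 0 :> fps K.
  by rewrite -!rmorphXn -(rmorph1 (@fpsC K)) -!rmorphD z0 rmorph0.
have rE k : rescale (z ^+ k) E = x + fpsC z ^+ k * y + fpsC z ^+ (k * 2) * w.
  have zk f : rescale (z ^+ k) (dilate 5 f) = dilate 5 f.
    by rewrite rescale_dilate // exprAC z5 expr1n.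
  have -> : fpsC z ^+ (k * 2) = fpsC (z ^+ k) ^+ 2 by rewrite exprM rmorphXn.
  have -> : fpsC z ^+ k = fpsC (z ^+ k) by rewrite rmorphXn.
  rewrite euler_xyw /x /w /y bE !(rmorphD, rmorphM, rmorphN, rmorphXn) /=.
  by rewrite rescaleX !zk rmorphXn; ring.
have Z5 : fpsC z ^+ 5 = 1 :> fps K by rewrite -rmorphXn z5 rmorph1.
rewrite dilate_quintic_const -(norm5_trinomial Z0 euler_xw) /norm5.
rewrite -[z in rescale z E]expr1 !rE -euler_xyw expr1 mul1n.
rewrite (_ : fpsC z ^+ (3 * 2) = fpsC z); last by rewrite (exprD _ 5 1) Z5 mul1r.
by rewrite (_ : fpsC z ^+ (4 * 2) = fpsC z ^+ 3); last by rewrite (exprD _ 5 3) Z5 mul1r.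
Qed.

Lemma euler_quintic :
  E ^+ 5 = - 5%:R * (q * b * E ^+ 4) - 15%:R * (q ^+ 2 * b ^+ 2 * E ^+ 3)
   - 25%:R * (q ^+ 3 * b ^+ 3 * E ^+ 2) - 25%:R * (q ^+ 4 * b ^+ 4 * E) + dilate 5 quintic_const.
Proof.
rewrite euler_xyw (quintic_trinomial euler_xw) -dilate_quintic_const /y; ring.
Qed.

End EulerRelations.

(** * Polynomial identities modulo 23 *)

Section Characteristic23.
Variable S : comNzRingType.
Hypothesis S23 : 23%:R = 0 :> S.

Lemma mod23 (p a c : S) : a = c + 23%:R * p -> a = c.
Proof. by move=> ->; rewrite S23 mul0r addr0. Qed.

(* [ring] does not reduce modulo 23: the argument of [mod23] is the quotient of
   the difference of both sides by 23. *)
Lemma quintic_recurrence_mod23 (m w : S) (U : nat -> S) :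
    (forall k, U k.+4.+1 = m * U k - 5%:R * (w * U k.+4) - 15%:R * (w ^+ 2 * U k.+3)
       - 25%:R * (w ^+ 3 * U k.+2) - 25%:R * (w ^+ 4 * U k.+1)) ->
    U 0 = 1 -> U 1 = - w -> U 2 = - w ^+ 2 -> U 3 = 5%:R * w ^+ 3 -> U 4 = - (5%:R * w ^+ 4) ->
  [/\ U 6 = - (6%:R * (m * w)) - 2%:R * w ^+ 6,
      U 12 = 8%:R * (m ^+ 2 * w ^+ 2) + 3%:R * w ^+ 12,
      U 18 = - (4%:R * (m ^+ 3 * w ^+ 3)) + 7%:R * w ^+ 18,
      U 22 = 2%:R * (m ^+ 4 * w ^+ 2) - 6%:R * (m ^+ 3 * w ^+ 7)
             - 6%:R * (m ^+ 2 * w ^+ 12) - 9%:R * w ^+ 22 &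
      U 24 = w ^+ 24].
Proof.
move=> urec u0 u1 u2 u3 u4.
have u5 : U 5 = m.
  by rewrite urec u4 u3 u2 u1 u0; ring.
have u6 : U 6 = - (6%:R * (m * w)) - 2%:R * w ^+ 6.
  by rewrite urec u5 u4 u3 u2 u1;
    apply: (@mod23 (- w ^+ 6)); ring.
have u7 : U 7 = - (9%:R * (m * w ^+ 2)) + 10%:R * w ^+ 7.
  by rewrite urec u6 u5 u4 u3 u2;
    apply: (@mod23 (m * w ^+ 2)); ring.
have u8 : U 8 = - (10%:R * w ^+ 8).
  by rewrite urec u7 u6 u5 u4 u3;
    apply: (@mod23 (5%:R * (m * w ^+ 3) + 5%:R * w ^+ 8)); ring.
have u9 : U 9 = 2%:R * (m * w ^+ 4) - 4%:R * w ^+ 9.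
  by rewrite urec u8 u7 u6 u5 u4;
    apply: (@mod23 (11%:R * (m * w ^+ 4) - 2%:R * w ^+ 9)); ring.
have u10 : U 10 = m ^+ 2 - 3%:R * (m * w ^+ 5) - 7%:R * w ^+ 10.
  by rewrite urec u9 u8 u7 u6 u5;
    apply: (@mod23 (16%:R * (m * w ^+ 5) - w ^+ 10)); ring.
have u11 : U 11 = - (11%:R * (m ^+ 2 * w)) + m * w ^+ 6 + 3%:R * w ^+ 11.
  by rewrite urec u10 u9 u8 u7 u6;
    apply: (@mod23 (9%:R * (m * w ^+ 6) + 4%:R * w ^+ 11)); ring.
have u12 : U 12 = 8%:R * (m ^+ 2 * w ^+ 2) + 3%:R * w ^+ 12.
  by rewrite urec u11 u10 u9 u8 u7;
    apply: (@mod23 (m ^+ 2 * w ^+ 2 + 19%:R * w ^+ 12)); ring.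
have u13 : U 13 = 8%:R * (m ^+ 2 * w ^+ 3) + 8%:R * w ^+ 13.
  by rewrite urec u12 u11 u10 u9 u8;
    apply: (@mod23 (4%:R * (m ^+ 2 * w ^+ 3) + 9%:R * w ^+ 13)); ring.
have u14 : U 14 = - (8%:R * w ^+ 14).
  by rewrite urec u13 u12 u11 u10 u9;
    apply: (@mod23 (4%:R * (m ^+ 2 * w ^+ 4) + 2%:R * (m * w ^+ 9) + w ^+ 14)); ring.
have u15 : U 15 = m ^+ 3 - 2%:R * (m ^+ 2 * w ^+ 5) - 9%:R * (m * w ^+ 10).
  by rewrite urec u14 u13 u12 u11 u10;
    apply: (@mod23 (- (2%:R * (m ^+ 2 * w ^+ 5)) - m * w ^+ 10 - 10%:R * w ^+ 15)); ring.
have u16 : U 16 = 7%:R * (m ^+ 3 * w) + 2%:R * (m ^+ 2 * w ^+ 6) + 2%:R * (m * w ^+ 11) + 6%:R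
      * w ^+ 16.
  by rewrite urec u15 u14 u13 u12 u11;
    apply: (@mod23 (- (m ^+ 3 * w) - 17%:R * (m ^+ 2 * w ^+ 6) + 2%:R * (m * w ^+ 11) - 7%:R *
      w ^+ 16)); ring.
have u17 : U 17 = 4%:R * (m ^+ 3 * w ^+ 2) + 4%:R * (m ^+ 2 * w ^+ 7) - 10%:R * (m * w ^+ 12) -
      7%:R * w ^+ 17.
  by rewrite urec u16 u15 u14 u13 u12;
    apply: (@mod23 (- (2%:R * (m ^+ 3 * w ^+ 2)) - 8%:R * (m ^+ 2 * w ^+ 7) + 6%:R * (m * w ^+
      12) - w ^+ 17)); ring.
have u18 : U 18 = - (4%:R * (m ^+ 3 * w ^+ 3)) + 7%:R * w ^+ 18.
  by rewrite urec u17 u16 u15 u14 u13;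
    apply: (@mod23 (- (6%:R * (m ^+ 3 * w ^+ 3)) + 11%:R * (m * w ^+ 13) + 6%:R * w ^+ 18));
      ring.
have u19 : U 19 = - (10%:R * (m ^+ 3 * w ^+ 4)) + 9%:R * (m ^+ 2 * w ^+ 9) - 5%:R * (m * w ^+
      14) - 11%:R * w ^+ 19.
  by rewrite urec u18 u17 u16 u15 u14;
    apply: (@mod23 (- (10%:R * (m ^+ 3 * w ^+ 4)) - 3%:R * (m ^+ 2 * w ^+ 9) + 14%:R * (m * w
      ^+ 14) - 3%:R * w ^+ 19)); ring.
have u20 : U 20 = m ^+ 4 - 6%:R * (m ^+ 3 * w ^+ 5) + 3%:R * (m ^+ 2 * w ^+ 10) - 5%:R * (m * w
      ^+ 15) - 2%:R * w ^+ 20.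
  by rewrite urec u19 u18 u17 u16 u15;
    apply: (@mod23 (- (7%:R * (m ^+ 3 * w ^+ 5)) - 9%:R * (m ^+ 2 * w ^+ 10) + 10%:R * (m * w
      ^+ 15) - w ^+ 20)); ring.
have u21 : U 21 = 2%:R * (m ^+ 4 * w) - 2%:R * (m ^+ 3 * w ^+ 6) + 5%:R * (m ^+ 2 * w ^+ 11) +
      11%:R * (m * w ^+ 16) - 9%:R * w ^+ 21.
  by rewrite urec u20 u19 u18 u17 u16;
    apply: (@mod23 (8%:R * (m ^+ 3 * w ^+ 6) - 11%:R * (m ^+ 2 * w ^+ 11) + 15%:R * (m * w ^+
      16) + 8%:R * w ^+ 21)); ring.
have u22 : U 22 = 2%:R * (m ^+ 4 * w ^+ 2) - 6%:R * (m ^+ 3 * w ^+ 7) - 6%:R * (m ^+ 2 * w ^+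
      12) - 9%:R * w ^+ 22.
  by rewrite urec u21 u20 u19 u18 u17;
    apply: (@mod23 (- (m ^+ 4 * w ^+ 2) + 20%:R * (m ^+ 3 * w ^+ 7) - 13%:R * (m ^+ 2 * w ^+
      12) + 6%:R * (m * w ^+ 17) + 8%:R * w ^+ 22)); ring.
have u23 : U 23 = - w ^+ 23.
  by rewrite urec u22 u21 u20 u19 u18;
    apply: (@mod23 (- (3%:R * (m ^+ 4 * w ^+ 3)) + 20%:R * (m ^+ 3 * w ^+ 8) - 15%:R * (m ^+ 2
      * w ^+ 13) + 4%:R * (m * w ^+ 18) + 22%:R * w ^+ 23)); ring.
have u24 : U 24 = w ^+ 24.
  by rewrite urec u23 u22 u21 u20 u19;
    apply: (@mod23 (- (5%:R * (m ^+ 4 * w ^+ 4)) + 13%:R * (m ^+ 3 * w ^+ 9) - 5%:R * (m ^+ 2 *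
      w ^+ 14) - 7%:R * (m * w ^+ 19) + 18%:R * w ^+ 24)); ring.
by split.
Qed.

(** To be read with X = E, Y = q E(q^25) and rho = q E(q^5)^6: the Hecke relation multiplied by E^2
    Y^2. *)
Lemma hecke25_polynomial (X Y : S)
    (rho := Y * (X ^+ 5 + 5%:R * (Y * X ^+ 4) + 15%:R * (Y ^+ 2 * X ^+ 3)
                 + 25%:R * (Y ^+ 3 * X ^+ 2) + 25%:R * (Y ^+ 4 * X))) :
  Y ^+ 2 * (- (10%:R * X ^+ 24) + 5%:R * (rho ^+ 2 * X ^+ 12)
            + 4%:R * (rho ^+ 3 * X ^+ 6) + 2%:R * rho ^+ 4) =
  13%:R * (X ^+ 24 * Y ^+ 2)
  - 9%:R * (X ^+ 2 * (2%:R * rho ^+ 4 - 6%:R * (rho ^+ 3 * Y ^+ 6)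
                      - 6%:R * (rho ^+ 2 * Y ^+ 12) - 9%:R * Y ^+ 24))
  - 12%:R * (X ^+ 2 * Y ^+ 24).
Proof.
(* Powers of [rho] are expanded one at a time with coefficients reduced modulo 23, to keep the
   integers small. *)
have r1 : rho = Y * X ^+ 5 + 5%:R * (Y ^+ 2 * X ^+ 4) - 8%:R * (Y ^+ 3 * X ^+ 3) + 2%:R * (Y ^+
      4 * X ^+ 2) + 2%:R * (Y ^+ 5 * X).
  by rewrite /rho; apply: (@mod23 (Y ^+ 3 * X ^+ 3 + Y ^+ 4 * X ^+ 2 + Y ^+ 5 * X)); ring.
have r2 : rho ^+ 2 = Y ^+ 2 * X ^+ 10 + 10%:R * (Y ^+ 3 * X ^+ 9) + 9%:R * (Y ^+ 4 * X ^+ 8) -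
      7%:R * (Y ^+ 5 * X ^+ 7) - 4%:R * (Y ^+ 6 * X ^+ 6) + 11%:R * (Y ^+ 7 * X ^+ 5) - 5%:R *
      (Y ^+ 8 * X ^+ 4) + 8%:R * (Y ^+ 9 * X ^+ 3) + 4%:R * (Y ^+ 10 * X ^+ 2).
  by rewrite expr2 r1; apply: (@mod23 (- (3%:R * (Y ^+ 5 * X ^+ 7)) + 4%:R * (Y ^+ 6 * X ^+ 6)
      - Y ^+ 7 * X ^+ 5 - Y ^+ 8 * X ^+ 4)); ring.
have r3 : rho ^+ 3 = Y ^+ 3 * X ^+ 15 - 8%:R * (Y ^+ 4 * X ^+ 14) + 5%:R * (Y ^+ 5 * X ^+ 13) +
      6%:R * (Y ^+ 6 * X ^+ 12) + 3%:R * (Y ^+ 7 * X ^+ 11) - 7%:R * (Y ^+ 8 * X ^+ 10) - 6%:R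
      * (Y ^+ 9 * X ^+ 9) + 11%:R * (Y ^+ 10 * X ^+ 8) + 6%:R * (Y ^+ 11 * X ^+ 7) - 9%:R * (Y
      ^+ 12 * X ^+ 6) - 3%:R * (Y ^+ 13 * X ^+ 5) + Y ^+ 14 * X ^+ 4 + 8%:R * (Y ^+ 15 * X ^+
      3).
  by rewrite exprSr r2 r1; apply: (@mod23 (Y ^+ 4 * X ^+ 14 + 2%:R * (Y ^+ 5 * X ^+ 13) - 2%:R
      * (Y ^+ 6 * X ^+ 12) - 4%:R * (Y ^+ 7 * X ^+ 11) + 4%:R * (Y ^+ 8 * X ^+ 10) + 4%:R * (Y
      ^+ 9 * X ^+ 9) - 6%:R * (Y ^+ 10 * X ^+ 8) + 4%:R * (Y ^+ 11 * X ^+ 7) - Y ^+ 12 * X ^+ 6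
      - Y ^+ 13 * X ^+ 5 + Y ^+ 14 * X ^+ 4)); ring.
have r4 : rho ^+ 4 = Y ^+ 4 * X ^+ 20 - 3%:R * (Y ^+ 5 * X ^+ 19) + 3%:R * (Y ^+ 6 * X ^+ 18) +
      5%:R * (Y ^+ 7 * X ^+ 17) + 2%:R * (Y ^+ 8 * X ^+ 16) + 3%:R * (Y ^+ 10 * X ^+ 14) + 9%:R
      * (Y ^+ 11 * X ^+ 13) + 9%:R * (Y ^+ 12 * X ^+ 12) - Y ^+ 13 * X ^+ 11 + 6%:R * (Y ^+ 14
      * X ^+ 10) + 8%:R * (Y ^+ 16 * X ^+ 8) + 8%:R * (Y ^+ 17 * X ^+ 7) + Y ^+ 18 * X ^+ 6 -
      5%:R * (Y ^+ 19 * X ^+ 5) - 7%:R * (Y ^+ 20 * X ^+ 4).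
  by rewrite exprSr r3 r1; apply: (@mod23 (- (2%:R * (Y ^+ 6 * X ^+ 18)) + 4%:R * (Y ^+ 7 * X
      ^+ 17) - Y ^+ 8 * X ^+ 16 - 2%:R * (Y ^+ 9 * X ^+ 15) - 2%:R * (Y ^+ 10 * X ^+ 14) + 2%:R
      * (Y ^+ 11 * X ^+ 13) + 4%:R * (Y ^+ 12 * X ^+ 12) - 4%:R * (Y ^+ 13 * X ^+ 11) - 4%:R *
      (Y ^+ 14 * X ^+ 10) + 4%:R * (Y ^+ 15 * X ^+ 9) + Y ^+ 16 * X ^+ 8 - 3%:R * (Y ^+ 18 * X
      ^+ 6) + Y ^+ 19 * X ^+ 5 + Y ^+ 20 * X ^+ 4)); ring.
rewrite r4 r3 r2.
apply: (@mod23 (- (Y ^+ 2 * X ^+ 24) + Y ^+ 4 * X ^+ 22 + 3%:R * (Y ^+ 6 * X ^+ 20) + 3%:R * (Y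
      ^+ 7 * X ^+ 19) + 2%:R * (Y ^+ 8 * X ^+ 18) + Y ^+ 9 * X ^+ 17 + 19%:R * (Y ^+ 10 * X ^+
      16) - 4%:R * (Y ^+ 11 * X ^+ 15) - 4%:R * (Y ^+ 12 * X ^+ 14) - 6%:R * (Y ^+ 13 * X ^+
      13) + 18%:R * (Y ^+ 14 * X ^+ 12) - 10%:R * (Y ^+ 15 * X ^+ 11) - 40%:R * (Y ^+ 16 * X ^+
      10) + 10%:R * (Y ^+ 17 * X ^+ 9) + 32%:R * (Y ^+ 18 * X ^+ 8) - 22%:R * (Y ^+ 19 * X ^+
      7) + 4%:R * (Y ^+ 20 * X ^+ 6) - 38%:R * (Y ^+ 21 * X ^+ 5) - 10%:R * (Y ^+ 22 * X ^+ 4)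
      - 3%:R * (Y ^+ 24 * X ^+ 2))); ring.
Qed.

End Characteristic23.

(** * Sections of powers and their linearity over series in q^5 *)

Section SectionOperators.
Variable R : comNzRingType.
Implicit Types f g : fps R.
Local Notation q := (fpsX : fps R).

Lemma section5_decomp f : f = \sum_(r < 5) q ^+ r * dilate 5 (section5 r f).
Proof.
apply: fpsP => n; rewrite coef_fps_sum.
have rlt := ltn_pmod n (isT : 0 < 5)%N.
rewrite (bigD1 (Ordinal rlt)) //= big1 ?addr0 => [|i /eqP ir].
  rewrite coef_fpsXnM leq_mod (_ : n - n %% 5 = n %/ 5 * 5 + 0)%N; last lia.
  by rewrite dilate5E // /section5; congr (f _); lia.
rewrite coef_fpsXnM; case: ifP => // le_in; rewrite /dilate ifF //.
apply/negbTE/negP => /dvdnP[k kE]; apply: ir; apply: val_inj => /=.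
by have := ltn_ord i; lia.
Qed.

Lemma section5_dilateM g f : section5 0 (dilate 5 g * f) = g * section5 0 f.
Proof.
rewrite {1}(section5_decomp f) big_distrr raddf_sum big_ord_recl /= big1 => [|i _] /=.
  by rewrite mulrCA -rmorphM (@section5_XnM _ 0 0) //= expr0 mul1r addr0.
by rewrite mulrCA -rmorphM section5_XnM0 // modn_small; case: i => -[|[|[|[|]]]].
Qed.

Lemma section5_shift k s r f : (s + r = 5 * k)%N -> (r < 5)%N ->
  section5 0 (q ^+ s * f) = q ^+ k * section5 r f.
Proof.
move=> sr r5; rewrite {1}(section5_decomp f) big_distrr raddf_sum /=.
rewrite (bigD1 (Ordinal r5)) //= big1 ?addr0 => [|i /eqP ir].
  by rewrite mulrA -exprD (@section5_XnM _ 0 k) // addn0.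
rewrite mulrA -exprD section5_XnM0 //; apply/eqP => h; apply: ir; apply: val_inj => /=.
by have := ltn_ord i; lia.
Qed.

Lemma section5_quintic (m u f0 f1 f2 f3 f4 : fps R) :
  section5 0 (q ^+ 20 * dilate 5 m * f0 - 5%:R * (q ^+ 5 * dilate 5 u * f4)
    - 15%:R * ((q ^+ 5 * dilate 5 u) ^+ 2 * f3) - 25%:R * ((q ^+ 5 * dilate 5 u) ^+ 3 * f2)
    - 25%:R * ((q ^+ 5 * dilate 5 u) ^+ 4 * f1)) =
  (q ^+ 4 * m) * section5 0 f0 - 5%:R * (q * u * section5 0 f4)
    - 15%:R * ((q * u) ^+ 2 * section5 0 f3) - 25%:R * ((q * u) ^+ 3 * section5 0 f2)
    - 25%:R * ((q * u) ^+ 4 * section5 0 f1).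
Proof.
have d0 : q ^+ 20 * dilate 5 m = dilate 5 (q ^+ 4 * m).
  by rewrite rmorphM rmorphXn /= dilateX // -exprM.
have d j c f : c%:R * ((q ^+ 5 * dilate 5 u) ^+ j * f) = dilate 5 (c%:R * (q * u) ^+ j) * f.
  rewrite [in RHS]rmorphM rmorph_nat [in RHS]rmorphXn [in RHS]rmorphM /=.
  by rewrite dilateX // mulrA.
rewrite -{1}[q ^+ 5 * dilate 5 u]expr1 -{4}[q * u]expr1.
by rewrite d0 !d !(raddfB (@section5 R 0)) /= !section5_dilateM !mulrA.
Qed.

(** Since 4(k+5) + j = 5j + 4(k+5-j), a weight p^4 per factor e turns every p^j of the quintic into
    p^(5j), which leaves [section5 0] as a scalar. *)
Lemma quintic_shift k (p t e V : fps R) :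
  e ^+ 5 = - 5%:R * (p * t * e ^+ 4) - 15%:R * (p ^+ 2 * t ^+ 2 * e ^+ 3)
   - 25%:R * (p ^+ 3 * t ^+ 3 * e ^+ 2) - 25%:R * (p ^+ 4 * t ^+ 4 * e) + V ->
  p ^+ (4 * k.+4.+1) * e ^+ k.+4.+1 =
    p ^+ 20 * V * (p ^+ (4 * k) * e ^+ k) - 5%:R * (p ^+ 5 * t * (p ^+ (4 * k.+4) * e ^+ k.+4))
    - 15%:R * ((p ^+ 5 * t) ^+ 2 * (p ^+ (4 * k.+3) * e ^+ k.+3))
    - 25%:R * ((p ^+ 5 * t) ^+ 3 * (p ^+ (4 * k.+2) * e ^+ k.+2))
    - 25%:R * ((p ^+ 5 * t) ^+ 4 * (p ^+ (4 * k.+1) * e ^+ k.+1)).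
Proof.
move=> e5; transitivity (p ^+ 20 * p ^+ (4 * k) * e ^+ k * e ^+ 5).
  by rewrite -exprD -mulrA -exprD; congr (p ^+ _ * e ^+ _); lia.
rewrite e5 !(mulnS 4) !exprD; move: (p ^+ (4 * k)) => x.
by rewrite !(exprS e); move: (e ^+ k) => y; ring.
Qed.

(** For j < 5 the class of j modulo 5 in e^j consists of the central monomials x^i y^(j-2i) w^i
    alone, which [ac] collapses to a multiple of u^j. *)
Lemma section5_trinomial (a u c : fps R) (ac : a * c = - u ^+ 2)
    (e := dilate 5 a - q * dilate 5 u + q ^+ 2 * dilate 5 c) :
  [/\ section5 0 (q ^+ 4 * e) = - (q * u),
      section5 0 (q ^+ 8 * e ^+ 2) = - (q * u) ^+ 2,
      section5 0 (q ^+ 12 * e ^+ 3) = 5%:R * (q * u) ^+ 3 &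
      section5 0 (q ^+ 16 * e ^+ 4) = - (5%:R * (q * u) ^+ 4)].
Proof.
have secD r := (raddfB (@section5 R r), raddfD (@section5 R r)).
have sec r f : (r < 5)%N -> section5 r (q ^+ r * dilate 5 f) = f.
  by move=> r5; rewrite (@section5_XnM _ r 0) // expr0 mul1r.
have simp := (sub0r, add0r, subr0, addr0).
split.
- rewrite (@section5_shift 1 _ 1) //.
  have -> : e = q ^+ 0 * dilate 5 a - q ^+ 1 * dilate 5 u + q ^+ 2 * dilate 5 c.
    by rewrite /e; ring.
  by rewrite !(secD 1%N) /= sec // !section5_XnM0 // !simp; ring.
- rewrite (@section5_shift 2 _ 2) //.
  have -> : e ^+ 2 = q ^+ 0 * dilate 5 (a ^+ 2) - q ^+ 1 * dilate 5 (2%:R * (a * u))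
    + q ^+ 2 * dilate 5 (2%:R * (a * c) + u ^+ 2) - q ^+ 3 * dilate 5 (2%:R * (u * c))
    + q ^+ 4 * dilate 5 (c ^+ 2) by rewrite /e; ring.
  by rewrite !(secD 2%N) /= sec // !section5_XnM0 // !simp ac; ring.
- rewrite (@section5_shift 3 _ 3) //.
  have -> : e ^+ 3 = q ^+ 0 * dilate 5 (a ^+ 3) - q ^+ 1 * dilate 5 (3%:R * (a ^+ 2 * u))
    + q ^+ 2 * dilate 5 (3%:R * (a * (a * c + u ^+ 2)))
    + q ^+ 3 * dilate 5 (- (u ^+ 3) - 6%:R * (u * (a * c)))
    + q ^+ 4 * dilate 5 (3%:R * (a * c ^+ 2) + 3%:R * (u ^+ 2 * c))
    - q ^+ 5 * dilate 5 (3%:R * (u * c ^+ 2)) + q ^+ 6 * dilate 5 (c ^+ 3) by rewrite /e; ring.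
  by rewrite !(secD 3%N) /= sec // !section5_XnM0 // !simp ac; ring.
rewrite (@section5_shift 4 _ 4) //.
have -> : e ^+ 4 = q ^+ 0 * dilate 5 (a ^+ 4) - q ^+ 1 * dilate 5 (4%:R * (a ^+ 3 * u))
  + q ^+ 2 * dilate 5 (4%:R * (a ^+ 3 * c) + 6%:R * (a ^+ 2 * u ^+ 2))
  - q ^+ 3 * dilate 5 (12%:R * (a ^+ 2 * u * c) + 4%:R * (a * u ^+ 3))
  + q ^+ 4 * dilate 5 (6%:R * (a * c) ^+ 2 + 12%:R * (u ^+ 2 * (a * c)) + u ^+ 4)
  - q ^+ 5 * dilate 5 (12%:R * (a * u * c ^+ 2) + 4%:R * (u ^+ 3 * c))
  + q ^+ 6 * dilate 5 (4%:R * (a * c ^+ 3) + 6%:R * (u ^+ 2 * c ^+ 2))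
  - q ^+ 7 * dilate 5 (4%:R * (u * c ^+ 3)) + q ^+ 8 * dilate 5 (c ^+ 4) by rewrite /e; ring.
by rewrite !(secD 4%N) /= sec // !section5_XnM0 // !simp ac; ring.
Qed.

End SectionOperators.

Lemma fps23 (R : comNzRingType) : 23%:R = 0 :> R -> 23%:R = 0 :> fps R.
Proof. by move=> R23; rewrite -(rmorph_nat (@fpsC R)) R23 rmorph0. Qed.

(** * Recurrence for the sections of powers of E *)

Section HeckeRelation.
Variable K : fieldType.
Hypothesis K23 : 23%:R = 0 :> K.
Variable z : K.
Hypothesis z0 : 1 + z + z ^+ 2 + z ^+ 3 + z ^+ 4 = 0.
Local Notation q := (fpsX : fps K).
Local Notation E := (euler K 1).
Local Notation T := (euler K 5).
Local Notation b := (euler K 25).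
Local Notation A := (section5 0 E).
Local Notation C := (section5 2 E).
Local Notation M := (quintic_const K).

Fact three_neq0 : 3%:R != 0 :> K.
Proof.
apply/eqP => K3; have : 24%:R = 1 :> K by rewrite (natrD _ 23 1) K23 add0r.
by rewrite (natrM _ 3 8) K3 mul0r => /esym/eqP; rewrite oner_eq0.
Qed.

(* [section5 0] is linear over series in [q ^+ 5], so the quintic equation of [E]
   makes these sections satisfy a linear recurrence. *)
Definition quintic_section k : fps K := section5 0 (q ^+ (4 * k) * E ^+ k).

Lemma quintic_section_rec k : quintic_section k.+4.+1 = (q ^+ 4 * M) * quintic_section k
  - 5%:R * (q * T * quintic_section k.+4)
  - 15%:R * ((q * T) ^+ 2 * quintic_section k.+3) - 25%:R * ((q * T) ^+ 3 * quintic_section k.+2)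
  - 25%:R * ((q * T) ^+ 4 * quintic_section k.+1).
Proof.
have bE : b = dilate 5 T by rewrite dilate_euler.
have quintic := euler_quintic three_neq0; rewrite bE in quintic.
rewrite {1}/quintic_section (quintic_shift _ quintic); exact: section5_quintic.
Qed.

Lemma quintic_section0 : quintic_section 0 = 1.
Proof. by rewrite /quintic_section muln0 !expr0 mulr1; apply: fpsP => -[]. Qed.

Lemma quintic_section_1234 : [/\ quintic_section 1 = - (q * T), quintic_section 2 = - (q * T) ^+ 2,
  quintic_section 3 = 5%:R * (q * T) ^+ 3 & quintic_section 4 = - (5%:R * (q * T) ^+ 4)].
Proof.
have := section5_trinomial (euler_sections three_neq0).
have <- : dilate 25 E = dilate 5 T by rewrite !dilate_euler.
by rewrite -euler_dissection.
Qed.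

End HeckeRelation.

(** * The two successive sections of E^22 *)

Section HeckeAlgebra.
Variable S : comNzRingType.
Hypothesis S23 : 23%:R = 0 :> S.
Implicit Types q M T E b : S.

(** The factor T^2 is what m^4 w^2 lacks to contain (M T)^4; M then disappears from every term. *)
Lemma first_section_algebra q M T E (m := q ^+ 4 * M) (w := q * T) : M * T = E ^+ 6 ->
  (2%:R * (m ^+ 4 * w ^+ 2) - 6%:R * (m ^+ 3 * w ^+ 7) - 6%:R * (m ^+ 2 * w ^+ 12)
    - 9%:R * w ^+ 22) * T ^+ 2 =
  q ^+ 18 * (2%:R * E ^+ 24 - 6%:R * (q * (T ^+ 6 * E ^+ 18))
    - 6%:R * (q ^+ 2 * (T ^+ 12 * E ^+ 12)) - 9%:R * (q ^+ 4 * T ^+ 24)).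
Proof.
move=> MT; rewrite (exprM E 6 4) (exprM E 6 3) (exprM E 6 2) -MT /m /w; ring.
Qed.

Lemma second_section_algebra q M T E s2 s3 s4
    (m := q ^+ 4 * M) (w := q * T) (rho := q * T ^+ 6) :
    M * T = E ^+ 6 -> q ^+ 20 * s4 = q * w ^+ 24 ->
    q ^+ 15 * s3 = q * (- (4%:R * (m ^+ 3 * w ^+ 3)) + 7%:R * w ^+ 18) ->
    q ^+ 10 * s2 = q * (8%:R * (m ^+ 2 * w ^+ 2) + 3%:R * w ^+ 12) ->
  q ^+ 20 * (2%:R * s4 - 6%:R * (E ^+ 6 * s3) - 6%:R * (E ^+ 12 * s2) - 9%:R * (E ^+ 24 * q)) =
  q ^+ 21 * (- (10%:R * E ^+ 24) + 5%:R * (rho ^+ 2 * E ^+ 12)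
    + 4%:R * (rho ^+ 3 * E ^+ 6) + 2%:R * rho ^+ 4).
Proof.
move=> MT e4 e3 e2; apply: (@mod23 _ S23 (- (q ^+ 21 * (E ^+ 24 + rho ^+ 2 * E ^+ 12
  + 2%:R * (rho ^+ 3 * E ^+ 6))))).
transitivity (2%:R * (q ^+ 20 * s4) - 6%:R * (q ^+ 5 * E ^+ 6 * (q ^+ 15 * s3))
  - 6%:R * (q ^+ 10 * E ^+ 12 * (q ^+ 10 * s2)) - 9%:R * (q ^+ 21 * E ^+ 24)); first by ring.
rewrite e4 e3 e2 (exprM E 6 4) (exprM E 6 2) -MT /rho /m /w; ring.
Qed.

End HeckeAlgebra.

Lemma section5_sum4 (R : comNzRingType) (A B C D a b c d : fps R) :
  section5 0 A = a -> section5 0 B = b -> section5 0 C = c -> section5 0 D = d ->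
  section5 0 (A - B - C - D) = a - b - c - d.
Proof. by move=> <- <- <- <-; rewrite !(raddfB (@section5 R 0)). Qed.

Section SectionsOfPower22.
Variable R : comNzRingType.
Hypothesis R23 : 23%:R = 0 :> R.
Local Notation q := (fpsX : fps R).
Variables E T M : fps R.
Hypothesis T_E : T = dilate 5 E.
Hypothesis MT : M * T = E ^+ 6.
Local Notation u k := (section5 0 (q ^+ (4 * k) * E ^+ k)).
Local Notation m := (q ^+ 4 * M).
Local Notation w := (q * T).
Hypothesis u_mod23 :
  [/\ u 6 = - (6%:R * (m * w)) - 2%:R * w ^+ 6,
      u 12 = 8%:R * (m ^+ 2 * w ^+ 2) + 3%:R * w ^+ 12,
      u 18 = - (4%:R * (m ^+ 3 * w ^+ 3)) + 7%:R * w ^+ 18,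
      u 22 = 2%:R * (m ^+ 4 * w ^+ 2) - 6%:R * (m ^+ 3 * w ^+ 7)
             - 6%:R * (m ^+ 2 * w ^+ 12) - 9%:R * w ^+ 22 &
      u 24 = w ^+ 24].
Local Notation g := (section5 2 (E ^+ 22)).

Lemma first_section : g * T ^+ 2 =
  2%:R * E ^+ 24 - 6%:R * (q * (T ^+ 6 * E ^+ 18))
    - 6%:R * (q ^+ 2 * (T ^+ 12 * E ^+ 12)) - 9%:R * (q ^+ 4 * T ^+ 24).
Proof.
have [_ _ _ u22 _] := u_mod23.
(* The shift is 4 * 22 + 2 = 5 * 18. *)
have ug : u 22 = q ^+ 18 * g by apply: section5_shift.
apply: (@fpsX_lreg _ 18); transitivity (u 22 * T ^+ 2); first by rewrite ug -mulrA.
rewrite u22; exact: first_section_algebra.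
Qed.

(** T is a series in q^5, so T^j leaves the section as E^j; a factor q moves class 4 to class 0, and
    the sections of E^24, E^18, E^12 that remain are known from the recurrence. *)
Lemma second_section (rho := q * T ^+ 6) : E ^+ 2 * section5 4 g =
  - (10%:R * E ^+ 24) + 5%:R * (rho ^+ 2 * E ^+ 12) + 4%:R * (rho ^+ 3 * E ^+ 6)
  + 2%:R * rho ^+ 4.
Proof.
have [_ u12 u18 _ u24] := u_mod23.
have TX j : T ^+ j = dilate 5 (E ^+ j) by rewrite T_E rmorphXn.
have sh j s f : q ^+ j * section5 0 (q ^+ s * f) = section5 0 (q ^+ (5 * j + s) * f).
  have qj : q ^+ (5 * j) = dilate 5 (q ^+ j) by rewrite rmorphXn /= dilateX // exprM.
  by rewrite exprD qj -mulrA section5_dilateM.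
have lhs : E ^+ 2 * (q * section5 4 g) = section5 0 (q * (g * T ^+ 2)).
  rewrite (TX 2) (mulrA q) (mulrC (q * g)) section5_dilateM; congr (_ * _).
  by rewrite -{2}[q]expr1 (@section5_shift _ 1 _ 4).
have sec c j f : section5 0 (c%:R * (T ^+ j * f)) = c%:R * (E ^+ j * section5 0 f).
  rewrite (_ : c%:R * (T ^+ j * f) = dilate 5 (c%:R * E ^+ j) * f).
    by rewrite section5_dilateM mulrA.
  by rewrite [in RHS]rmorphM rmorph_nat /= -TX mulrA.
have quintic_sectionE k j s : (5 * 1 + 4 * k = 5 * j + s)%N ->
    q * (u k) = q ^+ j * section5 0 (q ^+ s * E ^+ k).
  by move=> e; rewrite sh -e -sh expr1.
pose s4 := section5 0 (q ^+ 1 * E ^+ 24); pose s3 := section5 0 (q ^+ 2 * E ^+ 18).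
pose s2 := section5 0 (q ^+ 3 * E ^+ 12).
have lhs_sum : q * (E ^+ 2 * section5 4 g) =
    2%:R * s4 - 6%:R * (E ^+ 6 * s3) - 6%:R * (E ^+ 12 * s2) - 9%:R * (E ^+ 24 * q).
  rewrite (mulrCA q (E ^+ 2)) lhs first_section.
  transitivity (section5 0 (2%:R * (T ^+ 0 * (q ^+ 1 * E ^+ 24))
    - 6%:R * (T ^+ 6 * (q ^+ 2 * E ^+ 18)) - 6%:R * (T ^+ 12 * (q ^+ 3 * E ^+ 12))
    - 9%:R * (T ^+ 24 * (q ^+ 5 * 1)))); first by congr (section5 0 _); ring.
  apply: section5_sum4; rewrite sec ?mul1r //; congr (_ * (_ * _)).
  rewrite (@section5_shift _ 1 5 0) // (_ : section5 0 1 = 1) ?mulr1 //.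
  by apply: fpsP => -[].
apply: (@fpsX_lreg _ 21); transitivity (q ^+ 20 * (q * (E ^+ 2 * section5 4 g))).
  by rewrite /= (exprSr q 20) -mulrA.
(* The exponents split as 5+96 = 100+1, 5+72 = 75+2 and 5+48 = 50+3. *)
have e4 := etrans (esym (quintic_sectionE 24 20 1 erefl)%N) (congr1 (fun x => q * x) u24).
have e3 := etrans (esym (quintic_sectionE 18 15 2 erefl)%N) (congr1 (fun x => q * x) u18).
have e2 := etrans (esym (quintic_sectionE 12 10 3 erefl)%N) (congr1 (fun x => q * x) u12).
rewrite lhs_sum; exact: (second_section_algebra (fps23 R23) MT e4 e3 e2).
Qed.

Variable b : fps R.
Hypothesis b_T : b = dilate 5 T.
Hypothesis E0 : E 0%N = 1.
Hypothesis quintic : E ^+ 5 = - 5%:R * (q * b * E ^+ 4) - 15%:R * (q ^+ 2 * b ^+ 2 * E ^+ 3)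
   - 25%:R * (q ^+ 3 * b ^+ 3 * E ^+ 2) - 25%:R * (q ^+ 4 * b ^+ 4 * E) + dilate 5 M.

(** T^6 is the dilation of M T, that is the constant term of the quintic times b; the quintic gives
    that constant term in E and Y. *)
Lemma qT6_factor (Y := q * b) :
  q * T ^+ 6 = Y * (E ^+ 5 + 5%:R * (Y * E ^+ 4) + 15%:R * (Y ^+ 2 * E ^+ 3)
                 + 25%:R * (Y ^+ 3 * E ^+ 2) + 25%:R * (Y ^+ 4 * E)).
Proof.
have -> : T ^+ 6 = dilate 5 M * b by rewrite {1}T_E b_T -dilateM MT rmorphXn.
by rewrite quintic /Y; ring.
Qed.

Lemma dilate_first_section : dilate 5 g * b ^+ 2 =
  2%:R * T ^+ 24 - 6%:R * (q ^+ 5 * (b ^+ 6 * T ^+ 18))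
    - 6%:R * (q ^+ 10 * (b ^+ 12 * T ^+ 12)) - 9%:R * (q ^+ 20 * b ^+ 24).
Proof.
have bT2 : b ^+ 2 = dilate 5 (T ^+ 2) by rewrite b_T rmorphXn.
rewrite bT2 -dilateM first_section.
transitivity (2%:R * dilate 5 E ^+ 24 - 6%:R * (dilate 5 q * (dilate 5 T ^+ 6 * dilate 5 E ^+ 18))
    - 6%:R * (dilate 5 q ^+ 2 * (dilate 5 T ^+ 12 * dilate 5 E ^+ 12))
    - 9%:R * (dilate 5 q ^+ 4 * dilate 5 T ^+ 24)); first by ring.
by rewrite (@dilateX R 5 erefl) -T_E -b_T -!exprM.
Qed.

(** Both sides are multiplied by E^2 b^2 q^2, all cancellable, to reach the polynomial identity. *)
Lemma hecke_section : section5 4 g =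
  13%:R * E ^+ 22 - 9%:R * (q ^+ 2 * dilate 5 g) - 12%:R * (q ^+ 22 * b ^+ 22).
Proof.
have b0 : b 0%N = 1 by rewrite b_T T_E /dilate !dvdn0 !div0n.
apply: (fps_mulI (coef0_fps_exp 2 E0)).
apply: (fps_mulI (coef0_fps_exp 2 b0)); apply: (@fpsX_lreg _ 2).
have step : q ^+ 2 * (b ^+ 2 * (E ^+ 2 * section5 4 g)) =
    (q * b) ^+ 2 * (E ^+ 2 * section5 4 g) by ring.
rewrite /= step second_section.
have poly := hecke25_polynomial (fps23 R23) E (q * b); rewrite -qT6_factor in poly.
rewrite poly.
transitivity (13%:R * (E ^+ 24 * (q * b) ^+ 2)
  - 9%:R * (E ^+ 2 * (q ^+ 4 * (dilate 5 g * b ^+ 2)))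
  - 12%:R * (E ^+ 2 * (q * b) ^+ 24)).
  rewrite dilate_first_section; congr (_ - _ * (_ * _) - _); ring.
move: (dilate 5 g) => d; ring.
Qed.

End SectionsOfPower22.

Lemma ex_fifth_root_char23 : exists (K : fieldType) (z : K),
  23%:R = 0 :> K /\ 1 + z + z ^+ 2 + z ^+ 3 + z ^+ 4 = 0.
Proof.
have [K [iota _]] := countable_algebraic_closure 'F_23.
(* A solution of z^4 = -(1 + z + z^2 + z^3). *)
have [z zE] := @solve_monicpoly K 4 (fun=> -1) isT.
exists K, z; split; last by rewrite zE !big_ord_recl big_ord0 /=; ring.
by rewrite -(rmorph_nat iota) (_ : 23%:R = 0) ?rmorph0 //; apply/eqP.
Qed.

(** * The Hecke relation on coefficients *)

Section Coefficients.
Variable K : fieldType.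
Hypothesis K23 : 23%:R = 0 :> K.
Variable z : K.
Hypothesis z0 : 1 + z + z ^+ 2 + z ^+ 3 + z ^+ 4 = 0.
Local Notation q := (fpsX : fps K).
Local Notation E := (euler K 1).
Let f : fps K := E ^+ 22.

Lemma hecke25 : section5 4 (section5 2 f) =
  13%:R * f - 9%:R * (q ^+ 2 * dilate 5 (section5 2 f)) - 12%:R * (q ^+ 22 * dilate 25 f).
Proof.
have T_E : euler K 5 = dilate 5 E by rewrite dilate_euler.
have b_T : euler K 25 = dilate 5 (euler K 5) by rewrite dilate_euler.
have MT := quintic_const_mul (three_neq0 K23) z0.
have [u1 u2 u3 u4] := quintic_section_1234 K23.
have tab := quintic_recurrence_mod23 (fps23 K23) (quintic_section_rec K23)
  (quintic_section0 K) u1 u2 u3 u4.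
have E0 : E 0%N = 1 by exact: coef0_iprod.
rewrite (hecke_section K23 T_E MT tab b_T E0 (euler_quintic (three_neq0 K23))).
by congr (_ - _ * (_ * _)); rewrite rmorphXn /= dilate_euler.
Qed.

Lemma coef_hecke25 n : f (25 * n + 22)%N = 13%:R * f n
  - 9%:R * (if (n %% 5 == 2)%N then f n else 0)
  - 12%:R * (if (n %% 25 == 22)%N then f (n %/ 25)%N else 0).
Proof.
have -> : (25 * n + 22 = 5 * (5 * n + 4) + 2)%N by lia.
have nC (c : nat) : c%:R = fpsC c%:R :> fps K by rewrite rmorph_nat.
have := congr1 (fun F : fps K => F n) hecke25.
rewrite {1 2}/section5 !coef_fpsD !coef_fpsN !nC !coef_fpsCM !coef_fpsXnM => ->.
congr (_ - _ * _ - _ * _).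
- case: ifP => [n2|]; last by case: eqP => // h; lia.
  case: eqP => [h|nh].
    rewrite (_ : n - 2 = n %/ 5 * 5 + 0)%N; last lia.
    by rewrite dilate5E // /section5; congr (f _); lia.
  by rewrite /dilate ifF //; apply/negbTE/negP => /dvdnP[j jE]; apply: nh; lia.
case: ifP => [n22|]; last by case: eqP => // h; lia.
case: eqP => [h|nh].
  rewrite (_ : n - 22 = 25 * (n %/ 25))%N; last lia.
  by rewrite coef_dilate.
by rewrite /dilate ifF //; apply/negbTE/negP => /dvdnP[j jE]; apply: nh; lia.
Qed.

(** At 25n+22 both corrections are active; 13-9 = 4 and -12 = 11 modulo 23 are the coefficients of
    the recurrence of [a]. *)
Lemma coef_hecke25_rec n :
  f (25 * (25 * n + 22) + 22)%N = 4%:R * f (25 * n + 22)%N + 11%:R * f n.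
Proof.
rewrite coef_hecke25 !ifT; [|lia..].
rewrite (_ : (25 * n + 22) %/ 25 = n)%N; last lia.
apply: (@mod23 _ K23 (- f n)); ring.
Qed.

Lemma coef_hecke25_mod5 n : (n %% 5 = 2)%N -> (n %% 25 <> 22)%N ->
  f (25 * n + 22)%N = 4%:R * f n.
Proof. by move=> h2 h22; rewrite coef_hecke25 h2 eqxx (introF eqP h22); ring. Qed.

End Coefficients.

(** * Generating function of regular partitions *)

Section RegularPartitions.
Local Open Scope nat_scope.
Variable l : nat.

Definition allowed_part x := (x == 0%N) || ~~ (l %| x)%N.

(** [N] is the length including padding zeros, [m] bounds the entries and [n] is their sum;
    recursion is on the largest entry. *)
Fixpoint padded_partitions N m n : seq (seq nat) :=
  if N is N'.+1 then
    [seq h :: s | h <- [seq h <- iota 0 m.+1 | allowed_part h && (h <= n)%N],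
                  s <- padded_partitions N' h (n - h)]
  else if n == 0%N then [:: [::]] else [::].

Lemma padded_partitionsS N m n : padded_partitions N.+1 m n =
  [seq h :: s | h <- [seq h <- iota 0 m.+1 | allowed_part h && (h <= n)%N],
                s <- padded_partitions N h (n - h)].
Proof. by []. Qed.

Lemma mem_padded_partitions N m n s :
  (s \in padded_partitions N m n) =
  [&& size s == N, path geq m s, sumn s == n & all allowed_part s].
Proof.
elim: N m n s => [|N IH] m n s.
  by case: s => [|x s]; case: n => [|n]; rewrite ?inE.
rewrite padded_partitionsS.
apply/allpairsPdep/idP => [[h [t [hin tin ->]]]|].
  move: hin tin; rewrite mem_filter mem_iota IH /= => /andP[/andP[ah hn] hm].
  case/and4P=> /eqP <- pt /eqP st at_; rewrite eqxx pt ah at_ st subnKC // eqxx.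
  by rewrite -ltnS hm.
case: s => // h t /and4P[szt /andP[hm pt] /eqP /= st /andP[ah at_]].
have hr : h \in [seq h0 <- iota 0 m.+1 | allowed_part h0 && (h0 <= n)].
  by rewrite mem_filter ah mem_iota /= add0n ltnS -st leq_addr; apply: hm.
exists h, t; split=> //.
by rewrite IH; apply/and4P; split=> //; rewrite -st addKn.
Qed.

Lemma uniq_padded_partitions N m n : uniq (padded_partitions N m n).
Proof.
elim: N m n => [|N IH] m n; first by rewrite /=; case: ifP.
rewrite padded_partitionsS; apply: allpairs_uniq_dep => [|h _|]; first by rewrite filter_uniq // iota_uniq.
  exact: IH.
by move=> [h s] [h' s'] _ _ /= [-> ->].
Qed.

Lemma lregular_count n : b l n = size (padded_partitions n n n).
Proof.
rewrite /b cardE -(size_map (fun t : n.-tuple 'I_n.+1 => map val t)).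
apply: perm_size; apply: uniq_perm; rewrite ?uniq_padded_partitions //.
  by rewrite map_inj_uniq ?enum_uniq // => s t /(inj_map val_inj) /val_inj.
move=> s; rewrite mem_padded_partitions; apply/mapP/idP => [[t tin ->]|].
  move: tin; rewrite mem_enum inE /is_lregular_partition => /and3P[so -> ->].
  rewrite size_map size_tuple eqxx /= andbT path_min_sorted //.
  by apply/allP => _ /mapP[x _ ->]; rewrite /= -ltnS ltn_ord.
case/and4P=> /eqP szs ps sums als.
have ltn_s x : x \in s -> (x < n.+1)%N.
  move=> xs; rewrite ltnS.
  have tr : transitive geq by move=> y x' z' h1 h2; apply: leq_trans h2 h1.
  by have := order_path_min tr ps => /allP/(_ _ xs).
pose t : seq 'I_n.+1 := map inord s.
have szt : size t == n by rewrite size_map szs.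
have vt : map val (Tuple szt) = s.
  rewrite /= -map_comp -[RHS]map_id; apply/eq_in_map => x xs /=.
  by rewrite inordK // ltn_s.
exists (Tuple szt) => //; rewrite mem_enum inE /is_lregular_partition vt sums als andbT.
by rewrite (path_sorted ps).
Qed.

Lemma size_padded0 N n : size (padded_partitions N 0 n) = (n == 0%N).
Proof.
elim: N n => [|N IH] n /=; first by case: ifP.
by rewrite cats0 size_map subn0 IH.
Qed.

Lemma size_paddedS N m n : size (padded_partitions N.+1 m.+1 n) =
  (size (padded_partitions N.+1 m n) +
   (if ~~ (l %| m.+1) && (m.+1 <= n) then size (padded_partitions N m.+1 (n - m.+1)) else 0))%N.
Proof.
rewrite padded_partitionsS -addn1 iotaD filter_cat allpairs_cat size_cat; congr (_ + _)%N.
rewrite /= add0n /allowed_part /=; case: ifP => //= _.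
by rewrite cats0 size_map.
Qed.

(** Beyond length n only zeros can be added, so the count no longer depends on the length. *)
Lemma size_padded_stable N m n : n <= N ->
  size (padded_partitions N m n) = size (padded_partitions n m n).
Proof.
suff step M m' n' : n' <= M ->
    size (padded_partitions M.+1 m' n') = size (padded_partitions M m' n').
  by move/subnKC <-; elim: (N - n) => [|k IH]; rewrite ?addn0 // addnS step ?leq_addr.
elim: M m' n' => [|M IH] m' n' nM.
  move: nM; rewrite leqn0 => /eqP ->.
  elim: m' => [|m' IHm]; first by rewrite size_padded0.
  by rewrite size_paddedS andbF addn0 IHm.
elim: m' => [|m' IHm]; first by rewrite !size_padded0.
rewrite (size_paddedS M.+1) (size_paddedS M m' n') IHm; congr (_ + _); case: ifP => // _.
by apply: IH; lia.
Qed.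

Definition bounded_count m n := size (padded_partitions n m n).

Lemma bounded_count0 n : bounded_count 0 n = (n == 0).
Proof. exact: size_padded0. Qed.

(** Either m+1 does not occur, or one copy of it is removed; on generating functions this is
    multiplication by 1 - q^(m+1). *)
Lemma bounded_countS m n : bounded_count m.+1 n = bounded_count m n +
  (if ~~ (l %| m.+1) && (m.+1 <= n) then bounded_count m.+1 (n - m.+1) else 0).
Proof.
rewrite /bounded_count; case: n => [|n]; first by rewrite andbF addn0.
by rewrite size_paddedS; congr (_ + _); case: ifP => // _; apply: size_padded_stable; lia.
Qed.

Lemma bounded_count_diag m n : n <= m -> bounded_count m n = bounded_count n n.
Proof.
move=> nm; rewrite -(subnKC nm); elim: (m - n) => [|k IH]; first by rewrite addn0.
by rewrite addnS bounded_countS ifF ?addn0 //; apply/negP => /andP[_]; lia.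
Qed.

Local Open Scope ring_scope.
Variable R : comNzRingType.
Local Notation q := (fpsX : fps R).

Definition bounded_series m : fps R := fun n => (bounded_count m n)%:R.
Definition regular_series : fps R := fun n => (b l n)%:R.

Let F i : fps R := 1 - q ^+ i.+1.
Let nonmult i : fps R := if ~~ (l %| i.+1)%N then F i else 1.

Lemma bounded_series_prod m :
  bounded_series m * \prod_(i < m) nonmult i = 1 :> fps R.
Proof.
elim: m => [|m IH].
  by rewrite big_ord0 mulr1; apply: fpsP => n; rewrite /bounded_series bounded_count0.
rewrite big_ord_recr /= [_ * nonmult m]mulrC mulrA -[RHS]IH; congr (_ * _).
rewrite /nonmult; case: ifP => lm.
  apply: fpsP => n; rewrite mulrC /F mulrBl mul1r coef_fpsD coef_fpsN coef_fpsXnM.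
  rewrite /bounded_series bounded_countS lm /=; case: ifP => _; rewrite ?subr0 ?addn0 //.
  by rewrite natrD addrK.
by rewrite mulr1; apply: fpsP => n; rewrite /bounded_series bounded_countS lm addn0.
Qed.

Lemma regular_series_euler : (0 < l)%N -> regular_series * euler R 1 = euler R l.
Proof.
move=> l0; have Fok : prodable F by apply: (@prodable_1BX _ S).
have eulerE : euler R 1 = iprod nonmult * euler R l.
  rewrite -(@euler_sparse R l) // -iprodM; first last.
  - exact: (prodable_if (fun i => l %| i.+1)%N Fok).
  - exact: (prodable_if (fun i => ~~ (l %| i.+1)%N) Fok).
  apply: eq_iprod => i; rewrite /nonmult mul1n.
  by case: (l %| i.+1)%N; rewrite /= ?mulr1 ?mul1r.
rewrite eulerE mulrA -[RHS]mul1r; congr (_ * _); apply: eqmodX_eq => N.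
apply: (@eqmodX_leq _ _ N.+1) => //; rewrite -(bounded_series_prod N).
apply: eqmodXM; last by apply: iprodE; apply: (prodable_if (fun i => ~~ (l %| i.+1)%N) Fok).
by move=> n; rewrite ltnS => nN; rewrite /regular_series /bounded_series lregular_count bounded_count_diag.
Qed.

End RegularPartitions.

Lemma regular_series_prime (K : fieldType) (p : nat) : p \in [pchar K] ->
  regular_series p K = euler K 1 ^+ p.-1.
Proof.
move=> pK; have p0 := prime_gt0 (pcharf_prime pK).
have E0 : euler K 1 0%N = 1 by exact: coef0_iprod.
apply: (fps_mulI E0); rewrite mulrC regular_series_euler // -exprS prednK //.
rewrite -iprodX; last exact: prodable_euler.
apply: eq_iprod => i; rewrite mul1n.
have pF : p \in [pchar (fps K)].
  by rewrite inE (pcharf_prime pK) -(rmorph_nat (@fpsC K)) (pcharf0 pK) rmorph0 eqxx.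
rewrite -!(pFrobenius_autE pF) pFrobenius_autB_comm; last exact: mulrC.
by rewrite pFrobenius_aut1 pFrobenius_autE -exprM mulnC.
Qed.

(** * Iteration of n -> 25n+22 *)

Section Iteration.
Variable K : fieldType.
Hypothesis K23 : 23%:R = 0 :> K.
Variable z : K.
Hypothesis z0 : 1 + z + z ^+ 2 + z ^+ 3 + z ^+ 4 = 0.

Definition next_index n := (25 * n + 22)%N.

Lemma iter_next_index k n : (12 * iter k next_index n + 11 = 25 ^ k * (12 * n + 11))%N.
Proof.
elim: k => [|k IH]; first by rewrite expn0 mul1n.
by rewrite iterS expnS -mulnA -IH /next_index; lia.
Qed.

Lemma pow25_mod24 k : (25 ^ k %% 24 = 1)%N.
Proof. by rewrite -modnXm exp1n. Qed.

Let f n : K := (b 23 n)%:R.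
Let A k : K := (a k)%:~R.

Fact pchar23 : 23 \in [pchar K]. Proof. by rewrite inE K23 eqxx. Qed.

Lemma regular_coef n : f n = (euler K 1 ^+ 22) n.
Proof. by rewrite -(regular_series_prime pchar23). Qed.

Lemma f_rec n : f (next_index (next_index n)) = 4%:R * f (next_index n) + 11%:R * f n.
Proof. by rewrite !regular_coef; apply: (coef_hecke25_rec K23 z0). Qed.

Lemma f_next_mod5 n : (n %% 5 = 2)%N -> (n %% 25 <> 22)%N ->
  f (next_index n) = 4%:R * f n.
Proof. by move=> h2 h22; rewrite !regular_coef; apply: (coef_hecke25_mod5 K23 z0). Qed.

Lemma a_rec k : a k.+2 = 4 * a k.+1 + 11 * a k.
Proof. by rewrite /a /=; case: (a_aux k) => x y. Qed.

Lemma A_rec k : A k.+2 = 4%:R * A k.+1 + 11%:R * A k.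
Proof. by rewrite /A a_rec rmorphD !rmorphM. Qed.

Lemma A1 : A 1 = 0. Proof. by []. Qed.

(** The recurrence of [a] on residues in [nat], so that a(13) modulo 23 can be computed. *)
Definition step23 (p : nat * nat) := (p.2, (4 * p.2 + 11 * p.1) %% 23)%N.

Lemma natr_mod23 m : (m %% 23)%:R = m%:R :> K.
Proof. by rewrite [in RHS](divn_eq m 23) natrD natrM K23 mulr0 add0r. Qed.

Lemma A_step23 k : A k = (iter k step23 (1, 0)%N).1%:R.
Proof.
suff: A k = (iter k step23 (1, 0)%N).1%:R /\ A k.+1 = (iter k.+1 step23 (1, 0)%N).1%:R by case.
elim: k => [|k [IH1 IH2]]; first by split.
by split=> //; rewrite A_rec IH2 IH1 2!iterS /= natr_mod23 natrD !natrM.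
Qed.

(** Both sides satisfy the same recurrence, so k = 0 and k = 1 suffice; the latter is a(13) = 0
    modulo 23, found by evaluation. *)
Lemma A_add12 k : A (k + 12)%N = A 12 * A k.
Proof.
suff: A (k + 12)%N = A 12 * A k /\ A (k.+1 + 12)%N = A 12 * A k.+1 by case.
elim: k => [|k [IH1 IH2]].
  by rewrite A1 mulr0 (_ : A 0 = 1) // mulr1 [A (1 + 12)%N]A_step23.
by split=> //; rewrite [LHS](A_rec (k + 12)) (A_rec k) IH1 [A (k + 12).+1]IH2; ring.
Qed.

Lemma A_12_add1 k : A (12 * k).+1 = 0.
Proof.
elim: k => [|k IH]; first exact: A1.
by rewrite mulnS addnC -addSn A_add12 IH mulr0.
Qed.

(** The solution of the recurrence starting with 0, 1 is [A k.+1 / 11]; the factor 11 avoids the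
    division. *)
Lemma f_iter k n :
  11%:R * f (iter k next_index n) = 11%:R * (A k * f n) + A k.+1 * f (next_index n).
Proof.
suff: 11%:R * f (iter k next_index n) = 11%:R * (A k * f n) + A k.+1 * f (next_index n)
  /\ 11%:R * f (iter k.+1 next_index n) = 11%:R * (A k.+1 * f n) + A k.+2 * f (next_index n).
  by case.
elim: k => [|k [IH1 IH2]].
  have A0 : A 0 = 1 by [].
  by rewrite A_rec A1 A0 /=; split; ring.
split=> //; rewrite [f _]f_rec -iterS.
transitivity (4%:R * (11%:R * f (iter k.+1 next_index n))
  + 11%:R * (11%:R * f (iter k next_index n))); first by ring.
by rewrite IH1 IH2 (A_rec k.+1) (A_rec k); ring.
Qed.

Lemma eleven_neq0 : 11%:R != 0 :> K.
Proof.
apply/eqP => eleven_neq0; have : 23%:R = 1 :> K by rewrite (natrD _ 22 1) (natrM _ 11 2) eleven_neq0 mul0r add0r.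
by rewrite K23 => /esym/eqP; rewrite oner_eq0.
Qed.

Lemma f_iter12 k n : f (iter (12 * k) next_index n) = A (12 * k) * f n.
Proof. by apply: (mulfI eleven_neq0); rewrite f_iter A_12_add1 mul0r addr0. Qed.

(** For such n the first step multiplies by 4, so 11 A(12k+11) + 4 A(12k+12) = A(12k+13) = 0
    appears. *)
Lemma f_iter_zero k n : (n %% 5 = 2)%N -> (n %% 25 <> 22)%N ->
  f (iter (12 * k + 11) next_index n) = 0.
Proof.
move=> h2 h22; apply: (mulfI eleven_neq0); rewrite f_iter f_next_mod5 // mulr0.
transitivity (A (12 * k + 11).+2 * f n); first by rewrite A_rec; ring.
by rewrite (_ : (12 * k + 11).+2 = (12 * k.+1).+1)%N ?A_12_add1 ?mul0r //; lia.
Qed.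

Lemma int_eq0_char23 (x : int) : x%:~R = 0 :> K -> (23 %| x)%Z.
Proof.
rewrite {1}[x]intEsign rmorphM rmorphXn /= rmorphN1 => /eqP.
by rewrite mulf_eq0 signr_eq0 /= -(dvdn_pcharf pchar23) dvdzE.
Qed.

End Iteration.

(** Iteration multiplies 12n+11 by 25^(12k) = 5^(24k), which is 1 modulo 24; hence the division by
    12 is exact. *)
Lemma index_multiple n k :
  (5 ^ (24 * k) * n + 11 * (5 ^ (24 * k) - 1) %/ 12 = iter (12 * k) next_index n)%N.
Proof.
have := iter_next_index (12 * k) n; have := pow25_mod24 (12 * k).
rewrite (_ : 25 = 5 ^ 2)%N // -expnM (_ : 2 * (12 * k) = 24 * k)%N; last lia.
move: (5 ^ _)%N (iter _ _ _) => x j x24 e.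
have := divn_eq x 24; rewrite x24; move: (x %/ 24)%N => t xE; rewrite {}xE in e *.
by rewrite addnK (_ : 11 * (t * 24) = 22 * t * 12)%N ?mulnK //; nia.
Qed.

(** The start 25n+5r+2 satisfies 12(25n+5r+2)+11 = 5(60n+12r+7). It is 2 modulo 5, and r < 4 keeps
    it away from 22 modulo 25. *)
Lemma index_zero r n k :
  (5 ^ (24 * k + 24) * n + (5 ^ (24 * k + 23) * (12 * r + 7) - 11) %/ 12
   = iter (12 * k + 11) next_index (5 * (5 * n + r) + 2))%N.
Proof.
have := iter_next_index (12 * k + 11) (5 * (5 * n + r) + 2).
have := pow25_mod24 (12 * k + 11).
rewrite (_ : 25 = 5 ^ 2)%N // -expnM.
rewrite (_ : 24 * k + 24 = (2 * (12 * k + 11)).+2)%N; last lia.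
rewrite (_ : 24 * k + 23 = (2 * (12 * k + 11)).+1)%N; last lia.
rewrite !expnS; move: (5 ^ _)%N (iter _ _ _) => x j x24 e.
have := divn_eq x 24; rewrite x24; move: (x %/ 24)%N => t xE; rewrite {}xE in e *.
rewrite (_ : _ - 11 = (10 * t * (12 * r + 7) + 5 * r + 2) * 12)%N; last nia.
by rewrite mulnK //; nia.
Qed.
Local Close Scope ring_scope.

Theorem theorem1p3 :
  (forall n k : nat,
     ((b 23 (5 ^ (24 * k) * n + 11 * (5 ^ (24 * k) - 1) %/ 12))%:Z
        = (a (12 * k) * (b 23 n)%:Z)%R %[mod 23%:Z])%Z)
  /\
  (forall r n k : nat, r < 4 ->
     b 23 (5 ^ (24 * k + 24) * n + (5 ^ (24 * k + 23) * (12 * r + 7) - 11) %/ 12)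
       = 0 %[mod 23]).
Proof.
have [K [z [K23 z0]]] := ex_fifth_root_char23.
split=> [n k|r n k r4].
  apply/eqP; rewrite eqz_mod_dvd index_multiple; apply: (int_eq0_char23 K23).
  by rewrite rmorphB rmorphM /= -(f_iter12 K23 z0 k n) subrr.
rewrite index_zero; apply/eqP; rewrite mod0n; apply/eqP/eqP.
rewrite -/(dvdn 23 _) (dvdn_pcharf (pchar23 K23)) (f_iter_zero K23 z0) //; lia.
Qed.
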